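(* Let $G$ be a simple connected graph with vertex set $[n]=\{1,2,\dots,n\}$, and let $\Upsilon_{G,odd}$ be the set of odd $G$-partitionable permutations. Then there is a bijection from $\Upsilon_{G,odd}$ to the set of even-left spanning forests of $G$. Hence, $T_G(2,-1)=|\Upsilon_{G,odd}|$.
   Context: Tutte polynomial. For a (finite) graph $G=(V,E)$, $T_G(x,y)=\sum_{A\subseteq E}(x-1)^{r(G)-r(A)}(y-1)^{|A|-r(A)}$, where $r(A)=|V|-c(A)$, $c(A)$ is the number of connected components of the spanning subgraph $(V,A)$, and $r(G)=r(E)$. Sequence of a spanning tree. Let $H$ be a simple connected graph whose vertex set is a finite totally ordered set with $m$ elements (e.g. a subset of $[n]$), and let $T$ be a spanning tree of $H$. Define an ordering $\pi_T=(\pi_T(1),\dots,\pi_T(m))$ of $V(H)$ recursively: $\pi_T(1)$ is the maximum vertex of $H$; given $\pi_T(1),\dots,\pi_T(i)$, put $U_i=\{\pi_T(1),\dots,\pi_T(i)\}$ and let $\pi_T(i+1)$ be the smallest vertex $w\in V(H)\setminus U_i$ that is joined by an edge of $T$ to some vertex of $U_i$. Write $\pi_T^{-1}(v)$ for the position of $v$ in this sequence. For $v\in V(H)\setminus\{\pi_T(1)\}$: - the predecessor $p_T(v)$ is the unique vertex $u$ with $uv\in E(T)$ and $\pi_T^{-1}(u)<\pi_T^{-1}(v)$; - $N_{T,v}$ is the set of vertices $w$ with $wv\in E(H)\setminus E(T)$ and $\pi_T^{-1}(p_T(v))<\pi_T^{-1}(w)<\pi_T^{-1}(v)$; - the $(T;v)$-rightmost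 inversion vertex $r$ is the unique vertex with $r>v$, $\pi_T^{-1}(r)<\pi_T^{-1}(v)$, and $\pi_T(j)<v$ for all $\pi_T^{-1}(r)<j<\pi_T^{-1}(v)$ (i.e. the last vertex before $v$ in $\pi_T$ that is larger than $v$); - $M_{T,v}$ is the set of vertices $s$ with $sv\in E(H)\setminus E(T)$ and $\pi_T^{-1}(r)\le\pi_T^{-1}(s)<\pi_T^{-1}(p_T(v))$. The spanning tree $T$ of $H$ is even if $|N_{T,v}|$ is even for every $v\neq\pi_T(1)$; it is left if $M_{T,v}=\emptyset$ for every $v\ne\pi_T(1)$; it is even-left if it is both even and left. Even-left spanning forests. A spanning forest of $G$ is an acyclic subgraph with vertex set $V(G)$. If $F$ is a spanning forest of $G$ with connected components $T_1,\dots,T_t$, then each $T_i$ is a spanning tree of the induced subgraph $G_i=G[V(T_i)]$ (with vertex order inherited from $[n]$). $F$ is even-left if each $T_i$ is an even-left spanning tree of $G_i$. Odd $H$-permutations. Let $H$ be a simple graph (possibly disconnected) on a finite totally ordered vertex set with $m$ elements, and let $\sigma=a_1a_2\cdots a_m$ be a permutation of $V(H)$ in one-line notation such that $a_1$ is the maximum vertex. For $2\le i\le m$ let $j=\max\{k : 1\le k<i,\ a_k>a_i\}$ and $\tilde N_{\sigma,i}=\{k : j\le k<i,\ a_ka_i\in E(H)\}$. Let $E_1=\emptyset$; for $i\ge2$ let $E_i=E_{i-1}$ if $\tilde N_{\sigma,i}=\emptyset$, and otherwise $E_i=E_{i-1}\cup\{a_{k_0}a_i\}$ with $k_0=\min\tilde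 N_{\sigma,i}$. Let $F_\sigma$ be the spanning forest of $H$ with edge set $E_m$. The permutation $\sigma$ is an odd $H$-permutation if $F_\sigma$ is a spanning tree of $H$ and $|\tilde N_{\sigma,i}|$ is odd for all $2\le i\le m$. Basic decomposition. For a permutation $\sigma=a_1\cdots a_n$ (one-line notation), let $a_{i_1}$ be the maximum of all the entries, and $\sigma_1=a_{i_1}a_{i_1+1}\cdots a_n$; let $a_{i_2}$ be the maximum of $\{a_1,\dots,a_{i_1-1}\}$ and $\sigma_2=a_{i_2}\cdots a_{i_1-1}$; and so on until all entries are used. The resulting factorization $\sigma=\sigma_t\sigma_{t-1}\cdots\sigma_1$ is the basic decomposition of $\sigma$. Odd $G$-partitionable permutations. A permutation $\sigma$ of $[n]$ with basic decomposition $\sigma_t\cdots\sigma_1$ is an odd $G$-partitionable permutation if, for every $1\le i\le t$, $\sigma_i$ is an odd $G_i$-permutation, where $G_i$ is the subgraph of $G$ induced by the vertices appearing in $\sigma_i$. *)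

(* Defs.v *)
From mathcomp Require Import all_boot all_order all_fingroup all_algebra.

Set Implicit Arguments.
Unset Strict Implicit.
Unset Printing Implicit Defensive.

Import GRing.Theory.

(* The vertex set [n] = {1, ..., n} is rendered by 'I_n = {0, ..., n - 1} with
   its usual order.  Vertex sets are arbitrary subsets of 'I_n, so that induced
   subgraphs inherit the vertex order.  Edges are two-element vertex sets. *)
Record sgraph (n : nat) := SGraph {
  vset : {set 'I_n};
  eset : {set {set 'I_n}};
  sgraphP : [forall e in eset, (e \subset vset) && (#|e| == 2)]
}.

Section Graphs.

Variable n : nat.
Implicit Types (G H : sgraph n) (A T F : {set {set 'I_n}}) (v w : 'I_n).

Definition adj A : rel 'I_n := fun u v => [set u; v] \in A.

Definition ncomp G A : nat := n_comp (adj A) (vset G).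

Definition connected_graph G : bool := ncomp G (eset G) == 1.

Definition induced_edges A (C : {set 'I_n}) : {set {set 'I_n}} :=
  [set e in A | e \subset C].

Lemma induced_proof G (C : {set 'I_n}) :
  [forall e in induced_edges (eset G) C,
     (e \subset vset G :&: C) && (#|e| == 2)].
Proof.
apply/'forall_implyP => e; rewrite inE => /andP[eG eC].
have /forallP/(_ e) := sgraphP G; rewrite eG /= => /andP[eV ->].
by rewrite subsetI eV eC.
Qed.

Definition induced G (C : {set 'I_n}) : sgraph n := SGraph (induced_proof G C).

(* A duplicate-free sequence of vertices has size at most n, so n.-bseq
   ranges over all candidate simple cycles. *)
Definition acyclic A : bool :=
  ~~ [exists c : n.-bseq 'I_n, (2 < size c) && ucycleb (adj A) c].

(* Spanning forests and trees are identified with their edge sets. *)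
Definition spanning_forest G F : bool := (F \subset eset G) && acyclic F.

Definition spanning_tree H T : bool :=
  spanning_forest H T && (ncomp H T == 1).

Definition rk G A : nat := #|vset G| - ncomp G A.

Definition tutte G : {poly {poly int}} :=
  (\sum_(A in powerset (eset G))
     ('X - 1) ^+ (rk G (eset G) - rk G A) * ('Y - 1) ^+ (#|A| - rk G A))%R.

Definition max_vertex H : option 'I_n :=
  [pick v in vset H | [forall w in vset H, w <= v]].

Definition next_candidates H T (s : seq 'I_n) : {set 'I_n} :=
  [set w in vset H | (w \notin s) && has (fun u => adj T u w) s].

Fixpoint tree_seq_from H T (k : nat) (s : seq 'I_n) : seq 'I_n :=
  if k is k'.+1 then
    if [pick w in next_candidates H T s |
          [forall w' in next_candidates H T s, w <= w']] is Some w
    then tree_seq_from H T k' (rcons s w) else s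
  else s.

Definition tree_seq H T : seq 'I_n :=
  if max_vertex H is Some v then tree_seq_from H T #|vset H|.-1 [:: v]
  else [::].

(* Positions start at 0; only their order matters. *)
Definition tpos H T v : nat := index v (tree_seq H T).

(* The default value v is never used when T is a spanning tree of H and
   v is not the first vertex of tree_seq H T. *)
Definition tree_pred H T v : 'I_n :=
  odflt v [pick u | adj T u v && (tpos H T u < tpos H T v)].

Definition N_set H T v : {set 'I_n} :=
  [set w in vset H |
    ([set w; v] \in eset H :\: T) &&
    (tpos H T (tree_pred H T v) < tpos H T w < tpos H T v)].

(* Same remark on the default value. *)
Definition rightmost_inversion H T v : 'I_n :=
  odflt v [pick r in vset H |
    [&& v < r, tpos H T r < tpos H T v &
     [forall w in vset H, (tpos H T r < tpos H T w < tpos H T v) ==> (w < v)]]].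

Definition M_set H T v : {set 'I_n} :=
  [set s in vset H |
    ([set s; v] \in eset H :\: T) &&
    (tpos H T (rightmost_inversion H T v) <= tpos H T s
       < tpos H T (tree_pred H T v))].

Definition even_tree H T : bool :=
  [forall v in vset H, (Some v != max_vertex H) ==> ~~ odd #|N_set H T v|].

Definition left_tree H T : bool :=
  [forall v in vset H, (Some v != max_vertex H) ==> (M_set H T v == set0)].

Definition even_left_tree H T : bool := even_tree H T && left_tree H T.

Definition components G F : {set {set 'I_n}} :=
  equivalence_partition (connect (adj F)) (vset G).

Definition even_left_forests G : {set {set {set 'I_n}}} :=
  [set F | spanning_forest G F &&
    [forall C in components G F,
       even_left_tree (induced G C) (induced_edges F C)]].

End Graphs.

Section Permutations.

Variable n : nat.
Implicit Types (G H : sgraph n) (a s : seq 'I_n).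

Definition entry a (i : 'I_(size a)) : 'I_n := tnth (in_tuple a) i.

(* Positions are numbered from 0.  The maximum is over a nonempty set whenever
   a starts with its maximum, has no repetition, and i is not 0. *)
Definition last_larger a (i : 'I_(size a)) : nat :=
  \max_(k < size a | (k < i) && (entry i < entry k)) k.

Definition Nt_set H a (i : 'I_(size a)) : {set 'I_(size a)} :=
  [set k : 'I_(size a) |
    (last_larger i <= k < i) && ([set entry k; entry i] \in eset H)].

(* The recursion E_1, ..., E_m only adds edges, so E_m is the union of the
   edges added at each step. *)
Definition perm_forest H a : {set {set 'I_n}} :=
  \bigcup_(i < size a | 0 < i)
    (if [pick k in Nt_set H i | [forall k' in Nt_set H i, k <= k']] is Some k0
     then [set [set entry k0; entry i]] else set0).

Definition odd_graph_perm H a : bool :=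
  [&& perm_eq a (enum (vset H)),
      ohead a == max_vertex H,
      spanning_tree H (perm_forest H a)
    & [forall i : 'I_(size a), (0 < i) ==> odd #|Nt_set H i|]].

Definition max_index s : nat := find (fun x : 'I_n => all (fun y : 'I_n => y <= x) s) s.

(* The first argument is fuel; each step removes at least one entry. *)
Fixpoint basic_decomp_rec (k : nat) s : seq (seq 'I_n) :=
  match k, s with
  | k'.+1, _ :: _ =>
      drop (max_index s) s :: basic_decomp_rec k' (take (max_index s) s)
  | _, _ => [::]
  end.

(* The factors are listed as sigma_1, ..., sigma_t, i.e. from right to left. *)
Definition basic_decomp s : seq (seq 'I_n) := basic_decomp_rec (size s) s.

Definition one_line (p : 'S_n) : seq 'I_n := [seq p i | i <- enum 'I_n].

Definition odd_partitionable G (p : 'S_n) : bool :=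
  all (fun b => odd_graph_perm (induced G [set x in b]) b)
      (basic_decomp (one_line p)).

Definition Upsilon_odd G : {set 'S_n} := [set p | odd_partitionable G p].

End Permutations.

(* Main.v *)
(* For a sequence s of vertices call v a record if it exceeds everything before
   it; the blocks of the basic decomposition start at the records.  Say that s
   is a search order for an edge set A if, for every edge uv of A with u before
   v, v is not a record and everything strictly between u and v is smaller than
   v, and if every non-record has an earlier neighbour in A.  Every A has
   exactly one search order: the next vertex is the smallest neighbour of the
   vertices already listed or, if there is none, the smallest of the unused
   component maxima.  The records are then the maxima of the components of A, so the
   nullity of A is |A| minus the number of non-records.

   Let N(v) be the set of earlier G-neighbours u of a non-record v such that
   everything between u and v is smaller than v.  The edge sets with search
   order s are obtained by choosing a nonempty subset of N(v) for every
   non-record v.  As the sum of (-2)^(|S|-1) over the nonempty subsets S of N is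
   1 if |N| is odd and 0 otherwise, grouping the edge sets by search order turns
   T_G(2,-1) = sum_A (-2)^nullity(A) into the number of permutations for which
   every |N(v)| is odd; these are the odd G-partitionable ones.

   The bijection sends such a permutation to the forest joining each non-record
   v to the first element of N(v), with inverse the search order: a search order
   of a forest restricts on each component to the sequence of its tree, the
   forest is left iff the predecessor of each v is the first element of N(v),
   and N(v) then consists of the predecessor and N_{T,v}. *)
Require Import Defs.
From mathcomp Require Import all_boot all_order all_fingroup all_algebra.
From mathcomp Require Import zify.

Set Implicit Arguments.
Unset Strict Implicit.
Unset Printing Implicit Defensive.

(** * Search orders *)

Section SearchOrders.

Variable n : nat.
Implicit Types (A E : {set {set 'I_n}}) (s : seq 'I_n) (u v w h x y z r : 'I_n).

(** [index] places absent vertices at [size s], behind every entry, so for [v] in [s] any witness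
    [w] is itself an entry of [s]. *)
Definition nonrecord s v : bool :=
  [exists w : 'I_n, (index w s < index v s) && (v < w)].

Definition in_window s u v : bool :=
  [&& nonrecord s v, index u s < index v s &
    [forall w : 'I_n, (index u s < index w s < index v s) ==> (w < v)]].

Definition back_nbrs E s v : {set 'I_n} :=
  [set u | in_window s u v && adj E u v].

(** The first clause keeps edges inside [s] and excludes loops, so the two ends of an edge always
    have distinct positions. *)
Definition search_order s A : bool :=
  [&& [forall u, forall v, adj A u v ==> (u \in s) && (u != v)],
      [forall u, forall v,
         adj A u v && (index u s < index v s) ==> in_window s u v] &
      [forall v, (v \in s) && nonrecord s v ==>
         [exists u, adj A u v && (index u s < index v s)]]].

Lemma nonrecordP s v :
  reflect (exists2 w, index w s < index v s & v < w) (nonrecord s v).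
Proof.
by apply: (iffP existsP) => [[w /andP[]]|[w w1 w2]]; exists w; rewrite ?w1.
Qed.

Lemma in_windowP s u v :
  reflect [/\ nonrecord s v, index u s < index v s &
             forall w, index u s < index w s -> index w s < index v s -> w < v]
          (in_window s u v).
Proof.
apply: (iffP and3P) => [[h1 h2 /forallP h3]|[h1 h2 h3]]; split=> //.
  by move=> w w1 w2; have := h3 w; rewrite w1 w2.
by apply/forallP => w; apply/implyP => /andP[]; apply: h3.
Qed.

Lemma search_orderP s A :
  reflect [/\ forall u v, adj A u v -> (u \in s) /\ u != v,
              forall u v, adj A u v -> index u s < index v s ->
                in_window s u v &
              forall v, v \in s -> nonrecord s v ->
                exists2 u, adj A u v & index u s < index v s]
          (search_order s A).
Proof.
apply: (iffP and3P) => [[/forallP h1 /forallP h2 /forallP h3]|[h1 h2 h3]].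
  split=> [u v uv|u v uv lt|v vs nv].
  - by have /forallP/(_ v) := h1 u; rewrite uv => /andP[].
  - by have /forallP/(_ v) := h2 u; rewrite uv lt.
  - by have := h3 v; rewrite vs nv => /existsP[u /andP[]]; exists u.
split.
- apply/forallP => u; apply/forallP => v; apply/implyP => /h1[-> ->] //.
- apply/forallP => u; apply/forallP => v; apply/implyP => /andP[]; apply: h2.
- apply/forallP => v; apply/implyP => /andP[vs nv].
  by have [u uv lt] := h3 v vs nv; apply/existsP; exists u; rewrite uv.
Qed.

Lemma adjC A u v : adj A u v = adj A v u.
Proof. by rewrite /adj setUC. Qed.

Lemma connect_adj_sym A : connect_sym (adj A).
Proof. by apply: sym_connect_sym => u v; apply: adjC. Qed.

Lemma index_inj_in s u v : u \in s -> index u s = index v s -> u = v.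
Proof.
move=> us e; have vs : v \in s by rewrite -index_mem -e index_mem.
by rewrite -(nth_index u us) e nth_index.
Qed.

(** * Connectivity along a fixed search order *)

Section Fixed.

Variables (s : seq 'I_n) (A : {set {set 'I_n}}).
Hypothesis sA : search_order s A.

Lemma search_adj_mem u v : adj A u v -> (u \in s) * (v \in s).
Proof.
have [h _ _] := search_orderP _ _ sA => uv.
by have [-> _] := h u v uv; rewrite adjC in uv; have [-> _] := h v u uv.
Qed.

Lemma search_adj_lt u v : adj A u v ->
  index u s < index v s \/ index v s < index u s.
Proof.
move=> uv; have [h _ _] := search_orderP _ _ sA.
have [us ne] := h u v uv.
have: index u s != index v s by apply: contra ne => /eqP/(index_inj_in us)->.
lia.
Qed.

(** Bounding positions by [k] later yields paths that avoid a vertex placed after [k]. *)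
Definition adj_upto k : rel 'I_n :=
  [rel x y | [&& adj A x y, index x s <= k & index y s <= k]].

Lemma adj_upto_sym k : connect_sym (adj_upto k).
Proof.
apply: sym_connect_sym => x y.
by rewrite /adj_upto /= adjC [(index x s <= _) && _]andbC.
Qed.

(** Strong induction on the position of [v]. A record is its own [r]. A nonrecord has an earlier
    neighbour [u], whose [r] also serves [v]: entries strictly between [u] and [v] are below [v], so
    the earlier vertex exceeding [v] sits at or before [u], and [v <= r]. *)
Lemma search_connect_upto k v : v \in s -> index v s <= k -> exists r,
  [/\ connect (adj_upto k) v r, index r s <= index v s &
      forall w, index w s <= index v s -> w <= r].
Proof.
have [_ h2 h3] := search_orderP _ _ sA.
have [m] := ubnP (index v s); elim: m v => // m IH v lem vs lek.
have [nv|nv] := boolP (nonrecord s v); last first.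
  exists v; split=> // w; rewrite leq_eqVlt => /orP[/eqP|lt].
    by move/esym/(index_inj_in vs)->.
  by rewrite leqNgt; apply: contra nv => lt'; apply/nonrecordP; exists w.
have [u uv lt] := h3 v vs nv.
have [us _] := search_adj_mem uv.
have [||r [cr ler top]] := IH u _ us; [by lia | by lia |].
exists r; split.
- apply: connect_trans cr; apply: connect1; rewrite /adj_upto /= adjC uv lek.
  exact: ltnW (leq_trans lt lek).
- by lia.
have /in_windowP[/nonrecordP[z lz vz] _ hw] := h2 u v uv lt.
have le_vr : v <= r.
  have [lezu|ltuz] := leqP (index z s) (index u s).
    by have := top z lezu; lia.
  by have := hw z ltuz lz; lia.
move=> w; have [/top//|lt' le'] := leqP (index w s) (index u s).
move: le'; rewrite leq_eqVlt => /orP[/eqP/esym/(index_inj_in vs)<- //|lt''].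
by have := hw w lt' lt''; lia.
Qed.

Lemma search_connect_top v : v \in s -> exists r,
  [/\ connect (adj A) v r, index r s <= index v s &
      forall w, index w s <= index v s -> w <= r].
Proof.
move=> /search_connect_upto/(_ (leqnn _))[r [cr ler top]]; exists r; split=> //.
by apply: connect_sub cr => x y /and3P[xy _ _]; apply: connect1.
Qed.

(** The component of a record stays in the block that the record opens. This is an invariant along
    edges: a backward edge over [h] would put [h] below its later end, and a forward edge ends at a
    nonrecord, exceeded by some vertex at or before the current one. *)
Lemma search_connect_record h w : ~~ nonrecord s h -> connect (adj A) h w ->
  index h s <= index w s /\
  forall z, index h s < index z s -> index z s <= index w s -> z < h.
Proof.
move=> rech /connectP[p pth ->].
pose Q x := index h s <= index x s /\
  forall z : 'I_n, index h s < index z s -> index z s <= index x s -> z < h.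
rewrite -/(Q (last h p)); suff step x y : adj A x y -> Q x -> Q y.
  have gen q x : path (adj A) x q -> Q x -> Q (last x q).
    by elim: q x => //= y q IH x /andP[xy /IH{}IH] Qx; apply/IH/(step x).
  by apply: gen => //; split=> // z; lia.
move=> xy [lehx hx]; have [_ hw _] := search_orderP _ _ sA.
have [xs ys] := search_adj_mem xy.
have [lt|lt] := search_adj_lt xy.
  have /in_windowP[/nonrecordP[z0 lz0 yz0] _ btw] := hw x y xy lt.
  split; first by lia.
  have lez0 : index z0 s <= index x s.
    rewrite leqNgt; apply/negP => lt'; have := btw z0 lt' lz0; lia.
  have ltyh : y < h.
    have [z0h|hz0] := leqP z0 h; first by lia.
    have [lt1|lt1] := ltnP (index h s) (index z0 s).
      by have := hx z0 lt1 lez0; lia.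
    case/negP: rech; apply/nonrecordP; exists z0 => //.
    rewrite ltn_neqAle lt1 andbT; apply/eqP => e.
    have: z0 = h by apply: index_inj_in e; rewrite -index_mem; move: xs;
      rewrite -index_mem; lia.
    by move=> ez; rewrite ez ltnn in hz0.
  move=> z lthz; have [le' _|lt' le'] := leqP (index z s) (index x s).
    exact: hx.
  move: le'; rewrite leq_eqVlt => /orP[/eqP/esym/(index_inj_in ys)<- //|lt''].
  by have := btw z lt' lt''; lia.
rewrite adjC in xy; have /in_windowP[nx _ btw] := hw y x xy lt.
have lehx' : index h s < index x s.
  rewrite ltn_neqAle lehx andbT; apply/eqP => e.
  have: x = h by apply: index_inj_in xs _.
  by move=> exh; rewrite exh (negPf rech) in nx.
have xh := hx x lehx' (leqnn _).
split; last by move=> z z1 z2; apply: hx => //; lia.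
rewrite leqNgt; apply/negP => lt'.
have := btw h lt' lehx'; lia.
Qed.

(** The right-hand side does not mention [s], so all search orders of [A] share their records,
    namely the component maxima. *)
Lemma nonrecord_connect v : v \in s ->
  nonrecord s v = [exists w, connect (adj A) v w && (v < w)].
Proof.
move=> vs; apply/idP/existsP => [/nonrecordP[w ltw vw]|[w /andP[cvw ltvw]]].
  have [r [cr _ top]] := search_connect_top vs.
  by exists r; rewrite cr; have := top w (ltnW ltw); lia.
apply: contraLR isT => /search_connect_record/(_ cvw)[le h].
have [lt|] := ltnP (index v s) (index w s); first by have := h w lt (leqnn _);
  lia.
move=> le'; have e: index v s = index w s by apply/eqP; rewrite eqn_leq le le'.
by rewrite (index_inj_in vs e) ltnn in ltvw.
Qed.

End Fixed.

End SearchOrders.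

(** * Existence and uniqueness of the search order *)

Section Canonical.

Variable n : nat.
Implicit Types (A E : {set {set 'I_n}}) (s : seq 'I_n) (u v w h x y z r : 'I_n).

Lemma index_lt_mem s u v : v \in s -> index u s < index v s -> u \in s.
Proof. by rewrite -!index_mem; lia. Qed.

Lemma index_catl s t u v : v \in s ->
  (index u (s ++ t) < index v (s ++ t)) = (index u s < index v s).
Proof.
move=> vs; rewrite !index_cat vs; case: ifP => // us.
by move: vs; rewrite -index_mem (memNindex (negbT us)); lia.
Qed.

Lemma nonrecord_catl s t v : v \in s -> nonrecord (s ++ t) v = nonrecord s v.
Proof. by move=> vs; apply: eq_existsb => w; rewrite index_catl. Qed.

Lemma in_window_catl s t u v :
  v \in s -> in_window (s ++ t) u v = in_window s u v.
Proof.
move=> vs; rewrite /in_window nonrecord_catl // index_catl //.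
congr [&& _, _ & _]; apply: eq_forallb => w;
  rewrite [index w _ < _]index_catl //.
have [lt|] := boolP (index w s < index v s); last by rewrite !andbF.
by rewrite index_catl // (index_lt_mem vs lt).
Qed.

(** If [x < y], then [x] comes after [y] in [s'] and is a nonrecord there, hence also in [s] by
    [nonrecord_connect]. So [x] has a neighbour [u] in the common prefix, and in [s'] this edge
    passes over [y], forcing [y < x]. *)
Lemma search_order_next A s s' p x y q q' :
    (forall v, v \in s) -> (forall v, v \in s') -> uniq s -> uniq s' ->
    search_order s A -> search_order s' A ->
  s = p ++ x :: q -> s' = p ++ y :: q' -> ~~ (x < y).
Proof.
move=> fs fs' us us' sA sA' es es'; apply/negP => xy.
have xp : x \notin p by move: us;
  rewrite es cat_uniq /= negb_or -andbA => /and3P[].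
have yp : y \notin p.
  by move: us'; rewrite es' cat_uniq /= negb_or -andbA => /and3P[].
have iy : index y s' = size p by rewrite es' index_cat (negPf yp) /= eqxx addn0.
have yx : index y s' < index x s'.
  rewrite iy es' index_cat (negPf xp) /=.
  by case: eqP => [e|_]; [move: xy; rewrite e ltnn | rewrite addnS; lia].
have: nonrecord s' x by apply/nonrecordP; exists y.
rewrite (nonrecord_connect sA') // -(nonrecord_connect sA) // => nx.
have [_ _ /(_ x (fs x) nx)[u ux lt]] := search_orderP _ _ sA.
have up : u \in p.
  by move: lt; rewrite es !index_cat (negPf xp) /= eqxx; case: ifP => //; lia.
have [_ /(_ u x ux) win _] := search_orderP _ _ sA'.
have uy : index u s' < index y s'.
  by rewrite iy es' index_cat up index_mem.
have /in_windowP[_ _ /(_ y uy yx)] := win (ltn_trans uy yx).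
lia.
Qed.

(** Induction along the common prefix: [search_order_next], used in both directions, rules out
    different next entries. *)
Lemma search_order_unique A s s' :
    (forall v, v \in s) -> (forall v, v \in s') -> uniq s -> uniq s' ->
  search_order s A -> search_order s' A -> s = s'.
Proof.
move=> fs fs' us us' sA sA'.
have sz : size s = size s'.
  by apply/perm_size/uniq_perm => // x; rewrite fs fs'.
suff gen q q' p : s = p ++ q -> s' = p ++ q' -> q = q'.
  exact: (gen s s' [::]).
elim: q q' p => [|x q IH] [|y q'] p es es' //.
- by move: sz; rewrite es es' !size_cat /=; lia.
- by move: sz; rewrite es es' !size_cat /=; lia.
have exy : x = y.
  have h1 := search_order_next fs fs' us us' sA sA' es es'.
  have h2 := search_order_next fs' fs us' us sA' sA es' es.
  by apply: val_inj => /=; lia.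
rewrite -exy in es' *; congr cons; apply: (IH _ (rcons p x));
  by rewrite cat_rcons.
Qed.

(** * Component maxima and the greedy construction *)

Definition comp_top A r : bool := ~~ [exists w, connect (adj A) r w && (r < w)].

Lemma comp_topP A v : exists2 r, connect (adj A) v r & comp_top A r.
Proof.
case: (@arg_maxnP _ v (connect (adj A) v) (@nat_of_ord n) (connect0 _ v)).
move=> r cr top; exists r => //; apply/existsP => -[w /andP[cw]].
rewrite ltnNge (_ : w <= r) //; apply: (top w).
exact: connect_trans cr cw.
Qed.

Lemma comp_top_le A r w : comp_top A r -> connect (adj A) r w -> w <= r.
Proof.
by move=> /existsPn/(_ w) + c; rewrite c -leqNgt.
Qed.

Lemma comp_top_unique A r r' :
  comp_top A r -> comp_top A r' -> connect (adj A) r r' -> r = r'.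
Proof.
move=> tr tr' c; apply/val_inj/eqP; rewrite eqn_leq.
by rewrite (comp_top_le tr c) (comp_top_le tr') // connect_adj_sym.
Qed.

Lemma min_of_pred (P : pred 'I_n) v : P v ->
  exists2 x, P x & forall w, P w -> x <= w.
Proof.
by move=> Pv; case: (@arg_minnP _ v P (@nat_of_ord n) Pv) => x; exists x.
Qed.

(* The last three conditions say what the rest of A may look like: they are
   what makes the greedy choice of the next vertex preserve the others. *)
Definition partial_search A s : Prop :=
  [/\ uniq s,
      forall u v, v \in s -> adj A u v -> index u s < index v s ->
        in_window s u v,
      forall v, v \in s -> nonrecord s v ->
        exists2 u, adj A u v & index u s < index v s &
  [/\ forall u w, u \in s -> w \notin s -> adj A u w ->
        forall z, z \in s -> index u s < index z s -> z < w,
      forall r z, comp_top A r -> r \notin s -> z \in s -> z < r &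
      forall u r, u \in s -> connect (adj A) u r -> comp_top A r -> r \in s]].

Lemma partial_search_grow A s :
    (forall u v, adj A u v -> u != v) -> partial_search A s -> size s < n ->
  exists x, partial_search A (rcons s x).
Proof.
move=> irr [us hw hb [hf ht hr]] lts.
have [v0 v0s] : exists v, v \notin s.
  apply/existsP; rewrite -negb_forall; apply/negP => /forallP full.
  have /card_uniqP : uniq s := us.
  rewrite (eq_card (B := 'I_n)) ?card_ord => [e|x]; last by rewrite full.
  by rewrite -e ltnn in lts.
(* A component met by [s] already has its maximum in [s]; this makes an appended vertex of that
   component a nonrecord. *)
have topu u w : u \in s -> w \notin s -> connect (adj A) u w ->
    exists2 z, z \in s & w < z.
  move=> us' ws c; have [r cr tr] := comp_topP A u.
  exists r; first exact: hr us' cr tr.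
  rewrite ltn_neqAle (comp_top_le tr) ?andbT; last first.
    by apply: connect_trans c; rewrite connect_adj_sym.
  by apply: contra ws => /eqP/val_inj ->; apply: hr us' cr tr.
have old x u v : x \notin s -> v \in s ->
    [/\ nonrecord (rcons s x) v = nonrecord s v,
      in_window (rcons s x) u v = in_window s u v &
      (index u (rcons s x) < index v (rcons s x)) = (index u s < index v s)].
  by move=> xs vs; rewrite -cats1 nonrecord_catl // in_window_catl //
    index_catl.
have idx x : x \notin s -> index x (rcons s x) = size s.
  by move=> xs; rewrite -cats1 index_cat (negPf xs) /= eqxx addn0.
have idxl x u : u \in s -> index u (rcons s x) = index u s.
  by move=> us'; rewrite -cats1 index_cat us'.
have idxlt x z : x \notin s -> index z (rcons s x) < size s -> z \in s.
  move=> xs; rewrite -cats1 index_cat; case: ifP => // _.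
  by rewrite ltnNge leq_addr.
have idxs z : z \in s -> index z s < size s by rewrite index_mem.
pose front w := (w \notin s) && [exists u, (u \in s) && adj A u w].
(* If some outside vertex is adjacent to [s], the smallest one is appended; minimality keeps it
   below the outer ends of the other pending edges. *)
have [[w0 fw0]|nofront] := altP (@existsP _ front).
  have [x /andP[xs /existsP[u0 /andP[u0s u0x]]] xmin] := min_of_pred fw0.
  have rx r : connect (adj A) x r -> comp_top A r -> r \in s.
    by move=> c; apply: (hr u0) => //; apply: connect_trans c; apply: connect1.
  exists x; split.
  - by rewrite rcons_uniq xs.
  - move=> u v; rewrite mem_rcons inE => /orP[/eqP->|vs]; last first.
      by have [_ -> ->] := old x u v xs vs; apply: hw.
    rewrite idx // => ux /(idxlt _ _ xs) us'.
    apply/in_windowP; split; last 2 first.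
    + by rewrite idx // idxl // idxs.
    + move=> z; rewrite idx // idxl // => lt /[dup] lt' /(idxlt _ _ xs) zs.
      by move: lt; rewrite idxl //; apply: hf.
    have [z zs xz] := topu u x us' xs (connect1 ux).
    by apply/nonrecordP; exists z => //; rewrite idx // idxl // idxs.
  - move=> v; rewrite mem_rcons inE => /orP[/eqP->|vs]; last first.
      have [-> _ _] := old x v v xs vs => /hb-/(_ vs)[u uv lt].
      by exists u => //; have [_ _ ->] := old x u v xs vs.
    by move=> _; exists u0; rewrite // idx // idxl // idxs.
  split.
  - move=> u w; rewrite !mem_rcons !inE negb_or => ux /andP[wx ws] uw z.
    move: ux; rewrite mem_rcons inE => /orP[/eqP eu|us'].
      rewrite eu idx // => /orP[/eqP-> | zs]; first by rewrite idx // ltnn.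
      by rewrite idxl //; have := idxs z zs; lia.
    rewrite [index u _]idxl // => /orP[/eqP-> _|zs]; last by rewrite idxl //;
      apply: hf.
    rewrite ltn_neqAle xmin; first by rewrite andbT eq_sym; apply: contra wx.
    by rewrite /front ws; apply/existsP; exists u; rewrite us'.
  - move=> r z tr; rewrite !mem_rcons !inE negb_or => /andP[rx' rs].
    move=> /orP[/eqP->|zs]; last exact: ht.
    have [r' cr' tr'] := comp_topP A x.
    apply: leq_ltn_trans (ht r r' tr rs (rx r' cr' tr')).
    by apply: comp_top_le tr' _; rewrite connect_adj_sym.
  - move=> u r; rewrite !mem_rcons !inE => /orP[/eqP->|us'] c tr.
      by rewrite (rx r c tr) orbT.
    by rewrite (hr u r us' c tr) orbT.
(* Otherwise [s] is closed under adjacency, and the smallest component maximum outside [s] opens a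
   new block; minimality keeps the remaining maxima above every entry. *)
have nof u w : u \in s -> w \notin s -> ~~ adj A u w.
  move=> us' ws; apply: contra nofront => uw; apply/existsP; exists w.
  by rewrite /front ws; apply/existsP; exists u; rewrite us'.
have clos : closed (adj A) (mem s).
  move=> u w uw; apply/idP/idP => h; apply: contraLR isT => hN.
    by have := nof u w h hN; rewrite uw.
  by have := nof w u h hN; rewrite adjC uw.
have [r0 cr0 tr0] := comp_topP A v0.
have r0s : r0 \notin s.
  have e : (v0 \in s) = (r0 \in s) := closed_connect clos cr0.
  by rewrite -e.
have [x /andP[tx xs] xmin] :=
  @min_of_pred (fun r => comp_top A r && (r \notin s)) r0
    (introT andP (conj tr0 r0s)).
have notin u : u \in s -> ~~ adj A u x by move=> us'; apply: nof.
exists x; split.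
- by rewrite rcons_uniq xs.
- move=> u v; rewrite mem_rcons inE => /orP[/eqP->|vs]; last first.
    by have [_ -> ->] := old x u v xs vs; apply: hw.
  by rewrite idx // => ux /(idxlt _ _ xs)/notin; rewrite ux.
- move=> v; rewrite mem_rcons inE => /orP[/eqP->|vs]; last first.
    have [-> _ _] := old x v v xs vs => /hb-/(_ vs)[u uv lt].
    by exists u => //; have [_ _ ->] := old x u v xs vs.
  move=> /nonrecordP[z]; rewrite idx // => /(idxlt _ _ xs) zs xz.
  by have := ht x z tx xs zs; lia.
split.
- move=> u w; rewrite !mem_rcons !inE negb_or => /orP[/eqP->|us'] /andP[wx ws].
    move=> _ z; rewrite mem_rcons inE idx // => /orP[/eqP->|zs].
      by rewrite idx // ltnn.
    by rewrite idxl //; have := idxs z zs; lia.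
  by rewrite (negPf (nof u w us' ws)).
- move=> r z tr; rewrite !mem_rcons !inE negb_or => /andP[rx rs].
  move=> /orP[/eqP->|zs]; last exact: ht.
  rewrite ltn_neqAle xmin ?tr // andbT eq_sym.
  by apply: contra rx.
- move=> u r; rewrite !mem_rcons !inE => /orP[/eqP->|us'] c tr.
    by rewrite (comp_top_unique tx tr c) eqxx.
  by rewrite (hr u r us' c tr) orbT.
Qed.

Lemma search_order_exists A : (forall u v, adj A u v -> u != v) ->
  exists s, [/\ uniq s, forall v, v \in s & search_order s A].
Proof.
move=> irr.
have [s szs [us hw hb _]] : exists2 s, size s = n & partial_search A s.
  suff grow k : k <= n -> exists2 s, size s = k & partial_search A s.
    exact: grow.
  elim: k => [_|k IH ltk]; first by exists [::].
  have [s szs ps] := IH (ltnW ltk).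
  have [|x px] := partial_search_grow irr ps; first by rewrite szs.
  by exists (rcons s x) => //; rewrite size_rcons szs.
have full v : v \in s.
  have /subset_leqif_card[_] : s \subset [set: 'I_n] by apply/subsetP.
  move/card_uniqP: us => ->; rewrite cardsT card_ord szs eqxx => /esym.
  by move=> /subsetP-> //; rewrite inE.
exists s; split=> //; apply/search_orderP; split.
- by move=> u v uv; rewrite full; split=> //; apply: irr.
- by move=> u v; apply: hw.
- by move=> v; apply: hb.
Qed.

End Canonical.

(** * Counting the edge sets with a given search order *)

Section SubsetSums.

Import GRing.Theory.

(** The right-hand side is a product over all of [T], with factor [x + 1] on [B] and [0 + 1]
    elsewhere. Expanding it, a subset not contained in [B] picks up a factor 0. *)
Lemma sum_expr_card_subset (R : comPzRingType) (T : finType) (B : {set T})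
    (x : R) :
  (\sum_(S : {set T} | S \subset B) x ^+ #|S| = (x + 1) ^+ #|B|)%R.
Proof.
have -> : ((x + 1) ^+ #|B| = \prod_i ((if i \in B then x else 0) + 1) :> R)%R.
  rewrite -prodr_const [RHS](bigID (mem B)) /= [X in (_ * X)%R]big1 ?mulr1.
    by apply: eq_bigr => i ->.
  by move=> i /negPf->; rewrite add0r.
rewrite bigA_distr [RHS](bigID (fun S : {set T} => S \subset B)) /=.
rewrite [X in (_ + X)%R]big1 ?addr0 => [|S /subsetPn[i iS iB]]; last first.
  by rewrite (bigD1 i) //= iS (negPf iB) mul0r.
apply: eq_bigr => S /subsetP SB; rewrite -prodr_const [RHS](bigID (mem S)) /=.
rewrite [X in (_ * X)%R]big1 ?mulr1 => [|i /negPf-> //].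
by apply: eq_bigr => i iS; rewrite iS SB.
Qed.

(** At x = -2 the sum over all subsets is (-1)^|B|. Removing the term 1 of the empty set and
    dividing by -2 leaves 1 or 0 according to parity. *)
Lemma sum_nonempty_subsets (T : finType) (B : {set T}) :
  (\sum_(S : {set T} | (S \subset B) && (S != set0)) (- 2%:R) ^+ (#|S| - 1)
     = (odd #|B|)%:R :> int)%R.
Proof.
have tot := sum_expr_card_subset B (- 2%:R : int)%R.
rewrite (bigD1 set0) ?sub0set //= cards0 expr0 in tot.
have e2 : (\sum_(S : {set T} | (S \subset B) && (S != set0)) (- 2%:R) ^+ #|S|
    = - 2%:R * \sum_(S : {set T} | (S \subset B) && (S != set0))
                  (- 2%:R) ^+ (#|S| - 1) :> int)%R.
  rewrite mulr_sumr; apply: eq_bigr => S /andP[_]; rewrite -card_gt0 => S0.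
  by rewrite -exprS subn1 prednK.
move: tot; rewrite e2; set X := (\sum_(_ | _) _)%R.
rewrite (_ : (- 2%:R + 1 = -1 :> int)%R) // -signr_odd.
by case: (odd #|B|); rewrite ?expr1 ?expr0; lia.
Qed.

End SubsetSums.

(** * Edge sets as choices of earlier neighbours *)

Section Counting.

Import GRing.Theory.

Variable n : nat.
Implicit Types (A E : {set {set 'I_n}}) (s : seq 'I_n) (u v w x y z r : 'I_n).

Lemma edgeP (G : sgraph n) e : e \in eset G ->
  exists u v, [/\ e = [set u; v] & u != v].
Proof.
move=> eG; have /forallP/(_ e) := sgraphP G; rewrite eG /= => /andP[_ /cards2P].
by move=> [u [v [ne ->]]]; exists u, v.
Qed.

Lemma adj_neq (G : sgraph n) A u v : A \subset eset G -> adj A u v -> u != v.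
Proof.
move=> /subsetP AG /AG uvG; have /forallP/(_ [set u; v]) := sgraphP G.
by rewrite uvG /= cards2 => /andP[_]; case: (u != v).
Qed.

(** Taking roots is a bijection from component maxima to canonical roots, since each component has
    exactly one maximum. *)
Lemma card_comp_top (G : sgraph n) A : vset G = [set: 'I_n] ->
  ncomp G A = #|[set v | comp_top A v]|.
Proof.
move=> GV; have symA := connect_adj_sym A.
rewrite -(@card_in_imset _ _ (fingraph.root (adj A))); last first.
  move=> r r'; rewrite !inE => tr tr' e; apply: (comp_top_unique tr tr').
  by apply/(fingraph.rootP symA).
rewrite /ncomp /n_comp_mem; apply: eq_card => x.
rewrite !inE GV inE andbT; apply/idP/imsetP => [rx|[r _ ->]].
  have [r cr tr] := comp_topP A x; exists r; rewrite ?inE //.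
  by move/(fingraph.rootP symA): cr => <-; apply/esym/eqP.
exact: (roots_root symA).
Qed.

Lemma rk_nonrecord (G : sgraph n) A s :
    vset G = [set: 'I_n] -> (forall v, v \in s) -> search_order s A ->
  rk G A = #|[set v | nonrecord s v]|.
Proof.
move=> GV fs sA; rewrite /rk (card_comp_top _ GV) GV.
rewrite (_ : [set v | comp_top A v] = ~: [set v | nonrecord s v]).
  by rewrite cardsT -(cardsC [set v | nonrecord s v]) addnK.
by apply/setP => v; rewrite !inE (nonrecord_connect sA).
Qed.

(** [f v] is meant as the set of earlier neighbours chosen at [v]; [unglue] recovers it by orienting
    the edges along [s]. *)
Definition glue (f : {ffun 'I_n -> {set 'I_n}}) : {set {set 'I_n}} :=
  [set [set p.1; p.2] | p in [set p : 'I_n * 'I_n | p.1 \in f p.2]].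

Definition unglue s A : {ffun 'I_n -> {set 'I_n}} :=
  [ffun v => [set u | adj A u v && (index u s < index v s)]].

(** A condition on each coordinate separately, so that the admissible [f] form a [family], over
    which a sum of products factors. *)
Definition choices E s v (S : {set 'I_n}) : bool :=
  if nonrecord s v then (S \subset back_nbrs E s v) && (S != set0)
  else S == set0.

Lemma set2_eq (T : finType) (a b c d : T) :
  [set a; b] = [set c; d] -> (a = c /\ b = d) \/ (a = d /\ b = c).
Proof.
move=> e.
have: a \in [set c; d] by rewrite -e !inE eqxx.
have: b \in [set c; d] by rewrite -e !inE eqxx orbT.
have: c \in [set a; b] by rewrite e !inE eqxx.
have: d \in [set a; b] by rewrite e !inE eqxx orbT.
rewrite !inE => /pred2P h1 /pred2P h2 /pred2P h3 /pred2P h4.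
by case: h1 h2 h3 h4 => -> [] -> [] h3 [] h4; subst; auto.
Qed.

Lemma adj_glue f u v : adj (glue f) u v = (u \in f v) || (v \in f u).
Proof.
apply/imsetP/orP => [[[a b] /=]|].
  rewrite inE /= => ab /set2_eq[[-> ->]|[-> ->]]; by [left|right].
case=> h; first by exists (u, v); rewrite ?inE.
by exists (v, u); rewrite ?inE //= setUC.
Qed.

Lemma choices_window E s (f : {ffun 'I_n -> {set 'I_n}}) u v :
  f \in family (choices E s) -> u \in f v -> in_window s u v /\ adj E u v.
Proof.
move=> /familyP/(_ v); rewrite unfold_in /choices.
case: ifP => [_ /andP[/subsetP h _] /h|_ /eqP->]; last by rewrite inE.
by rewrite inE => /andP.
Qed.

Lemma in_window_lt s u v : in_window s u v -> index u s < index v s.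
Proof. by case/and3P. Qed.

(** An edge comes from one ordered pair only, since the reversed pair would place each end before
    the other. Edges are thus counted at their later ends. *)
Lemma card_glue E s f : f \in family (choices E s) ->
  #|glue f| = \sum_v #|f v|.
Proof.
move=> fF; rewrite card_in_imset => [|[a b] [c d]]; last first.
  rewrite !inE /= => ab cd /set2_eq[[-> ->] //|[e1 e2]]; subst.
  have [/in_window_lt h1 _] := choices_window fF ab.
  have [/in_window_lt h2 _] := choices_window fF cd.
  by have := ltn_trans h1 h2; rewrite ltnn.
rewrite -sum1_card (eq_bigl (fun p : 'I_n * 'I_n => p.1 \in f p.2)); last first.
  by move=> p; rewrite inE.
rewrite -(pair_big_dep xpredT (fun u v => u \in f v) (fun _ _ => 1)) /=.
rewrite (exchange_big_dep xpredT) //=; apply: eq_bigr => v _.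
by rewrite sum1_card.
Qed.

Section FullOrder.

Variables (G : sgraph n) (s : seq 'I_n).
Hypothesis full_s : forall v, v \in s.

Lemma unglueK A : A \subset eset G -> search_order s A ->
  glue (unglue s A) = A.
Proof.
move=> AG sA; apply/setP => e; apply/imsetP/idP => [[[u v]]|eA].
  by rewrite !inE ffunE inE /= => /andP[h _ ->].
have [u [v [ee ne]]] := edgeP (subsetP AG e eA).
have uv : adj A u v by rewrite /adj -ee.
case: (search_adj_lt sA uv) => lt.
  by exists (u, v); rewrite //= inE ffunE inE uv.
by exists (v, u); rewrite /= 1?setUC // inE ffunE inE adjC uv.
Qed.

(** The left-hand side is the condition that [reindex_onto] produces when edge sets are replaced by
    choices; this explains the last conjunct. *)
Lemma glue_choices f :
  [&& glue f \subset eset G, search_order s (glue f) & unglue s (glue f) == f]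
    = (f \in family (choices (eset G) s)).
Proof.
apply/idP/idP => [/and3P[/subsetP gG sg /eqP ef]|fF].
  have [_ h2 h3] := search_orderP _ _ sg.
  apply/familyP => v; rewrite unfold_in /choices -ef ffunE.
  case: ifP => [nv|nv].
    apply/andP; split.
      apply/subsetP => u; rewrite !inE => /andP[uv lt].
      by rewrite h2 //=; apply: gG.
    have [u uv lt] := h3 v (full_s v) nv.
    by apply/set0Pn; exists u; rewrite inE uv.
  rewrite -subset0; apply/subsetP => u; rewrite inE => /andP[uv lt].
  by have /in_windowP[] := h2 u v uv lt; rewrite nv.
have lts u v : u \in f v -> index u s < index v s.
  by move=> /(choices_window fF)[/in_window_lt].
have lts' u v : adj (glue f) u v -> index u s < index v s -> u \in f v.
  rewrite adj_glue => /orP[//|/lts]; lia.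
have sub : glue f \subset eset G.
  apply/subsetP => e /imsetP[[u v]]; rewrite inE /= => uv ->.
  by have [_] := choices_window fF uv.
apply/and3P; split=> //.
  apply/search_orderP; split=> [u v /(adj_neq sub)//|u v uv lt|v _ nv].
    by have [] := choices_window fF (lts' u v uv lt).
  have /familyP/(_ v) := fF; rewrite unfold_in /choices nv.
  move=> /andP[_ /set0Pn[u uv]]; exists u; last exact: lts.
  by rewrite adj_glue uv.
apply/eqP/ffunP => v; rewrite ffunE; apply/setP => u; rewrite inE.
apply/andP/idP => [[]|uv]; first exact: lts'.
by rewrite adj_glue uv lts.
Qed.

(** In terms of choices the exponent is a sum over vertices, so the whole sum is a product of one
    factor per vertex: [sum_nonempty_subsets] evaluates it at a nonrecord, and it is 1 at a
    record. *)
Lemma sum_search_order :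
  (\sum_(A : {set {set 'I_n}} | (A \subset eset G) && search_order s A)
     (- 2%:R) ^+ (#|A| - #|[set v | nonrecord s v]|)
   = [forall v, nonrecord s v ==> odd #|back_nbrs (eset G) s v|]%:R :> int)%R.
Proof.
rewrite (reindex_onto glue (unglue s)) => [|A /andP[]]; last exact: unglueK.
under eq_bigl => f do rewrite -andbA glue_choices.
pose w v (S : {set 'I_n}) : int := ((- 2%:R) ^+ (#|S| - nonrecord s v))%R.
transitivity (\sum_(f in family (choices (eset G) s)) \prod_v w v (f v))%R.
  apply: eq_bigr => f fF; rewrite (card_glue fF) /w -expr_sum.
  (* Truncated differences may be summed separately because [f v] is nonempty at every nonrecord. *)
  congr (_ ^+ _)%R; rewrite sumnB.
    congr (_ - _); rewrite -sum1_card big_mkcond /=.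
    by apply: eq_bigr => v _; rewrite inE; case: nonrecord.
  move=> v _; have /familyP/(_ v) := fF; rewrite unfold_in /choices.
  by case: nonrecord => // /andP[_]; rewrite card_gt0.
rewrite -(bigA_distr_big_dep (choices (eset G) s) w).
transitivity (\prod_v (nonrecord s v ==> odd #|back_nbrs (eset G) s v|)%:R
  : int)%R.
  apply: eq_bigr => v _; rewrite /w /choices; case: nonrecord => /=.
    exact: sum_nonempty_subsets.
  by rewrite big_pred1_eq cards0.
case: forallP => [h|nh].
  by rewrite big1 // => v _; rewrite h.
have [v nv] : exists v, ~~ (nonrecord s v ==> odd #|back_nbrs (eset G) s v|).
  by apply/existsP; rewrite -negb_forall; apply/negP => /forallP.
by rewrite (bigD1 v) //= (negPf nv) mul0r.
Qed.

End FullOrder.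

End Counting.

(** * Search orders of forests *)

Section Forests.

Variable n : nat.
Implicit Types (A E : {set {set 'I_n}}) (s : seq 'I_n) (u v w x y z r : 'I_n).

Definition unique_back s A : Prop := forall u u' v, adj A u v -> adj A u' v ->
  index u s < index v s -> index u' s < index v s -> u = u'.

(** The vertex of a cycle that is last in [s] has its two cycle neighbours before it. Uniqueness
    identifies them, which a repetition-free cycle of size at least 3 forbids. *)
Lemma unique_back_acyclic s A :
  search_order s A -> unique_back s A -> acyclic A.
Proof.
move=> sA uA; apply/existsP => -[c /andP[sz /andP[cyc uc]]].
have [v0 v0c] : exists v, v \in (c : seq _).
  by move: sz; case: {cyc uc}(c : seq _) => //= v p _; exists v;
    rewrite inE eqxx.
case: (@arg_maxnP _ v0 [in (c : seq _)] (fun v => index v s) v0c) => v vc vmax.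
(* Rotating the cycle to start at [v] exposes the two neighbours of [v] as the first and last
   entries of [p]. *)
have [i p ep] := rot_to vc.
have {cyc} : path.cycle (adj A) (v :: p) by rewrite -ep rot_cycle.
have {uc} : uniq (v :: p) by rewrite -ep rot_uniq.
have {sz} : 2 < size (v :: p) by rewrite -ep size_rot.
have {vmax} vmax u : u \in v :: p -> index u s <= index v s.
  by rewrite -ep mem_rot; apply: vmax.
case: p {ep} vmax => [|u p] // vmax sz /andP[vp /andP[up _]] /=.
rewrite rcons_path => /andP[vu /andP[_ uv]].
have lp : last u p \in p by case: p sz {vmax vp up uv} => //= x p _;
  rewrite mem_last.
have lt x : adj A x v -> x \in v :: u :: p -> index x s < index v s.
  move=> xv /vmax le; case: (search_adj_lt sA xv) => // lt.
  by have := leq_trans lt le; rewrite ltnn.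
move: up; rewrite (_ : u = last u p) 1?lp //.
rewrite adjC in vu; apply: (uA _ _ v) => //; apply: lt => //.
  by rewrite !inE eqxx orbT.
by rewrite !inE lp !orbT.
Qed.

(** Two earlier neighbours of [v] are each connected, through vertices before [v], to a prefix
    maximum. The window condition makes these maxima equal, so a path joining the neighbours and
    avoiding [v] closes to a cycle through [v]. *)
Lemma acyclic_unique_back s A :
  search_order s A -> acyclic A -> unique_back s A.
Proof.
move=> sA acy; suff main u u' v : adj A u v -> adj A u' v ->
    index u s < index v s -> index u' s < index v s ->
      ~~ (index u s < index u' s).
  move=> u u' v uv u'v lt lt'.
  have [us _] := search_adj_mem sA uv.
  have h1 := main u u' v uv u'v lt lt'.
  have h2 := main u' u v u'v uv lt' lt.
  by apply: index_inj_in us _; lia.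
move=> uv u'v lt lt'; apply/negP => luu'.
have [us _] := search_adj_mem sA uv; have [u's _] := search_adj_mem sA u'v.
(* Positions up to [k] are exactly those before [v], whose position is positive because [u] precedes
   it. *)
pose k := (index v s).-1.
have [|r [cr ler top]] := search_connect_upto sA (k := k) us; first by lia.
have [|r' [cr' ler' top']] := search_connect_upto sA (k := k) u's; first by lia.
have [_ /(_ u v uv lt)/in_windowP[/nonrecordP[z lz vz] _ btw] _] :=
  search_orderP _ _ sA.
have vr : v < r.
  have [lezu|ltuz] := leqP (index z s) (index u s).
    by have := top z lezu; lia.
  by have := btw z ltuz lz; lia.
(* Since [u] precedes [u'], [r <= r']. Conversely [r'] lies at or before [u], or strictly between
   [u] and [v], where it is below [v] and so below [r]. *)
have err' : r = r'.
  apply/val_inj/eqP; rewrite eqn_leq; apply/andP; split.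
    by apply: top'; lia.
  have [le|lt1] := leqP (index r' s) (index u s); first exact: top.
  by apply: ltnW; apply: ltn_trans vr; apply: btw => //; lia.
have: connect (adj_upto s A k) u u'.
  by apply: connect_trans cr _; rewrite err' (adj_upto_sym s A k).
move=> /connectP[p pth elast].
case/shortenP: pth elast => p' pth uq _ elast.
have le_k x : x \in u :: p' -> index x s <= k.
  move=> xp; have: k >= index u s by lia.
  elim: p' u pth xp {uq elast cr us uv lt top luu' btw ler} => [|y p' IH] u /=.
    by rewrite inE => _ /eqP->.
  rewrite inE => /andP[/and3P[_ _ le] pth] /orP[/eqP->//|xp _].
  exact: IH pth xp le.
have vnotin : v \notin u :: p' by apply/negP => /le_k; lia.
(* Cycles are sought among sequences of size at most [n]; the bound holds because this one has no
   repetition. *)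
have szc : size (v :: u :: p') <= n.
  have /card_uniqP <- : uniq (v :: u :: p') by rewrite cons_uniq vnotin.
  by rewrite -[X in _ <= X]card_ord max_card.
case/negP: acy; apply/existsP; exists (Bseq szc).
have -> : 2 < size (Bseq szc).
  by rewrite /=; case: (p') elast => //= eu; move: luu'; rewrite eu ltnn.
rewrite /ucycleb cons_uniq vnotin uq /= adjC uv rcons_path -elast u'v !andbT.
by apply: sub_path pth => x y /and3P[].
Qed.

(** * The forest of first earlier neighbours *)

Definition first_back E s u v : bool :=
  (u \in back_nbrs E s v) &&
  [forall w in back_nbrs E s v, index u s <= index w s].

Definition first_forest E s : {set {set 'I_n}} :=
  [set e | [exists u, exists v, first_back E s u v && (e == [set u; v])]].

Lemma adj_first_forest E s u v :
  adj (first_forest E s) u v = first_back E s u v || first_back E s v u.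
Proof.
rewrite /adj inE; apply/existsP/orP => [[a /existsP[b /andP[ab /eqP]]]|].
  by move=> /set2_eq[[-> ->]|[-> ->]]; [left|right].
case=> h; first by exists u; apply/existsP; exists v; rewrite h eqxx.
by exists v; apply/existsP; exists u; rewrite h setUC eqxx.
Qed.

Lemma first_back_lt E s u v : first_back E s u v -> index u s < index v s.
Proof. by case/andP; rewrite inE => /andP[/in_window_lt]. Qed.

Lemma first_back_unique E s u u' v :
  first_back E s u v -> first_back E s u' v -> u = u'.
Proof.
move=> /[dup] fu /andP[bu /forall_inP hu] /[dup] fu' /andP[bu' /forall_inP hu'].
have us : u \in s.
  have := first_back_lt fu; rewrite -index_mem => /leq_trans; apply.
  exact: index_size.
by apply: (index_inj_in us); apply/eqP; rewrite eqn_leq hu // hu'.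
Qed.

Lemma first_back_exists E s v :
  back_nbrs E s v != set0 -> exists u, first_back E s u v.
Proof.
move=> /set0Pn[u0 bu0].
case: (@arg_minnP _ u0 [in back_nbrs E s v] (fun u => index u s) bu0) =>
  u bu hu.
by exists u; rewrite /first_back bu; apply/forall_inP.
Qed.

Lemma first_forest_back E s u v :
  adj (first_forest E s) u v -> index u s < index v s -> first_back E s u v.
Proof. by rewrite adj_first_forest => /orP[//|/first_back_lt]; lia. Qed.

Lemma first_forest_unique E s : unique_back s (first_forest E s).
Proof.
move=> u u' v uv u'v lt lt'.
by apply: (@first_back_unique E s u u' v); apply: first_forest_back.
Qed.

Lemma first_forest_sub E s : first_forest E s \subset E.
Proof.
apply/subsetP => e; rewrite inE =>
  /existsP[u /existsP[v /andP[/andP[bu _] /eqP->]]].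
by move: bu; rewrite inE => /andP[].
Qed.

(** Odd sets are nonempty, so each nonrecord has an edge to a first earlier neighbour; the window
    condition is inherited from [back_nbrs]. *)
Lemma first_forest_search E s :
    (forall u v, adj E u v -> (u \in s) /\ u != v) ->
    (forall v, v \in s -> nonrecord s v -> odd #|back_nbrs E s v|) ->
  search_order s (first_forest E s).
Proof.
move=> Es hb; apply/search_orderP; split.
- by move=> u v uv; apply: Es; apply: (subsetP (first_forest_sub E s)).
- move=> u v uv lt; have /andP[] := first_forest_back uv lt.
  by rewrite inE => /andP[].
- move=> v vs nv; have [|u fu] := @first_back_exists E s v.
    by rewrite -card_gt0; case: #|_| (hb v vs nv).
  exists u; last exact: first_back_lt fu.
  by rewrite adj_first_forest fu.
Qed.

End Forests.

(** * Basic decomposition and odd permutations *)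

Section Blocks.

Variable n : nat.
Implicit Types (A E T : {set {set 'I_n}}) (b s t : seq 'I_n).
Implicit Types (u v w x y z r h : 'I_n) (G : sgraph n).

Definition headed h t : Prop := uniq (h :: t) /\ (forall x, x \in t -> x < h).

(** The last two clauses make [h] a record of [s] and the entry following [b], if any, the next
    record. *)
Definition is_block s b : Prop := exists s1 s2 h t,
  [/\ s = s1 ++ b ++ s2, b = h :: t, headed h t,
      forall x, x \in s1 -> x < h &
      forall h' s2', s2 = h' :: s2' -> h < h'].

Lemma max_index_split s : uniq s -> s != [::] -> exists h t,
  [/\ max_index s < size s, drop (max_index s) s = h :: t &
      forall x, x \in take (max_index s) s ++ t -> x < h].
Proof.
move=> us s0; set i := max_index s.
have hs : has (fun x : 'I_n => all (fun y : 'I_n => y <= x) s) s.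
  case: s s0 {us i} => // x0 s _.
  case: (@arg_maxnP _ x0 [in x0 :: s] (@nat_of_ord n) (mem_head _ _)) =>
    m ms mm.
  by apply/hasP; exists m => //; apply/allP => y ys; apply: mm.
have lti : i < size s by rewrite -has_find.
have /hasP[x0 _ _] := hs.
have /allP := nth_find x0 hs; rewrite -/(max_index s) -/i => top.
exists (nth x0 s i), (drop i.+1 s); rewrite -(drop_nth x0 lti); split=> //.
move=> x xs.
have xs' : x \in s.
  by move: xs; rewrite mem_cat => /orP[/mem_take|/mem_drop].
rewrite ltn_neqAle top // andbT; apply/eqP => /val_inj ex.
move: us; rewrite -{1}(cat_take_drop i s) (drop_nth x0 lti).
by rewrite -cat_rcons -cats1 -catA uniq_catCA catA /= -ex xs.
Qed.

(** Induction on the fuel. The factor split off starts at the maximum; any other factor lies in the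
    remaining prefix and is followed by an entry of that prefix or by this maximum. *)
Lemma basic_decomp_block s b : uniq s -> b \in basic_decomp s -> is_block s b.
Proof.
rewrite /basic_decomp; elim: (size s) {-2}s => [|k IH] {}s us //=.
case: s us => // x0 s' us; set s := x0 :: s' in us *.
have [|h [t [lti ed top]]] := max_index_split us; first by [].
rewrite inE => /orP[/eqP->|/IH].
  exists (take (max_index s) s), [::], h, t; rewrite cats0 cat_take_drop ed.
  split=> //; last by move=> x xs; apply: top; rewrite mem_cat xs.
  split; first by rewrite -ed drop_uniq.
  by move=> x xs; apply: top; rewrite mem_cat xs orbT.
case=> [|s1 [s2 [h1 [t1 [es eb hd top1 hs2]]]]]; first by rewrite take_uniq.
exists s1, (s2 ++ drop (max_index s) s), h1, t1; split=> //.
  by rewrite -{1}(cat_take_drop (max_index s) s) es -!catA.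
move=> h' s2'; case: s2 es hs2 => [|h2 s2] es hs2 /=; last first.
  by move=> [<- _]; apply: hs2.
rewrite ed => -[<- _]; apply: top.
by rewrite es eb !mem_cat mem_head orbT.
Qed.

Lemma basic_decomp_cover s v : uniq s -> v \in s ->
  exists2 b, b \in basic_decomp s & v \in b.
Proof.
move=> us vs; suff gen k : forall s, size s <= k -> uniq s -> v \in s ->
    exists2 b, b \in basic_decomp_rec k s & v \in b by exact: gen.
elim: k {s us vs} => [|k IH] [|x0 s'] // lek us vs; rewrite /=.
set s := x0 :: s' in lek us vs *.
have [|h [t [lti ed top]]] := max_index_split us; first by [].
move: vs; rewrite -{1}(cat_take_drop (max_index s) s) mem_cat => /orP[vt|vd].
  have [||b bb vb] := IH _ _ _ vt.
  - by rewrite size_take lti -ltnS (leq_trans lti).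
  - by rewrite take_uniq.
  by exists b => //; rewrite inE bb orbT.
by exists (drop (max_index s) s) => //; rewrite inE eqxx.
Qed.

Lemma headed_nonrecord h t v :
  headed h t -> v \in h :: t -> nonrecord (h :: t) v = (v != h).
Proof.
move=> [ub top] vb; apply/nonrecordP/idP => [[w lt vw]|vh].
  apply/eqP => e; move: lt; rewrite e /= eqxx; lia.
exists h; first by rewrite /= eqxx eq_sym (negPf vh).
by apply: top; move: vb; rewrite inE (negPf vh).
Qed.

(** If [u] came before the block, its head [h] would lie strictly between [u] and [v] and exceed
    [v]. What follows the block does not affect positions up to [v]. *)
Lemma in_window_block s b u v : uniq s -> is_block s b -> v \in b ->
  in_window s u v = in_window b u v.
Proof.
move=> us [s1 [s2 [h [t [es eb hd top1 _]]]]] vb; move: us.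
rewrite es catA cat_uniq => /andP[us _].
rewrite in_window_catl ?mem_cat ?vb ?orbT //.
have nin w : w \in b -> w \notin s1.
  move: us; rewrite cat_uniq => /and3P[_ /hasPn h1 _]; apply: h1.
have ix w : w \notin s1 -> index w (s1 ++ b) = size s1 + index w b.
  by move=> ws; rewrite index_cat (negPf ws).
have ix1 w : w \in s1 -> index w (s1 ++ b) < size s1.
  by move=> ws; rewrite index_cat ws index_mem.
have hb : h \in b by rewrite eb mem_head.
apply/in_windowP/in_windowP => -[/nonrecordP[z lz vz] lt btw].
  (* The head exceeds all of [s1], hence is a record of [s], unlike [v]. *)
  have vh : v != h.
    apply/eqP => e; move: lz; rewrite e (ix h) ?nin // {2}eb /= eqxx addn0.
    move=> lz; have zs : z \in s1.
      by apply: contraLR lz => /ix->; lia.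
    by move: vz; rewrite e; have := top1 z zs; lia.
  have nv : nonrecord b v by rewrite eb headed_nonrecord -?eb.
  have uns : u \notin s1.
    apply/negP => us1; have := btw h; rewrite !(ix h, ix v) ?nin //.
    rewrite {1 2}(_ : index h b = 0) ?addn0 => [/(_ (ix1 u us1))|]; last first.
      by rewrite eb /= eqxx.
    have: v < h by case: hd => _; apply; move: vb; rewrite eb inE (negPf vh).
    have: 0 < index v b by rewrite eb /= eq_sym (negPf vh).
    lia.
  have ixv := ix v (nin v vb); rewrite (ix u uns) ixv in lt btw.
  split=> //; first by lia.
  move=> w w1 w2; have wb : w \in b by apply: index_lt_mem w2.
  by apply: btw; rewrite (ix w (nin w wb)); lia.
have ub : u \in b by apply: index_lt_mem lt.
have zb : z \in b by apply: index_lt_mem lz.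
split.
- by apply/nonrecordP; exists z => //; rewrite !(ix _ (nin _ _)) ?ltn_add2l.
- by rewrite !(ix _ (nin _ _)) ?ltn_add2l.
move=> w; rewrite (ix u (nin u ub)) (ix v (nin v vb)).
have [/ix1 h1|ws] := boolP (w \in s1); first by lia.
by rewrite (ix w ws) => w1 w2; apply: btw; lia.
Qed.

Lemma block_nonrecord s b v : uniq s -> is_block s b -> v \in b ->
  nonrecord s v = nonrecord b v.
Proof.
move=> us [s1 [s2 [h [t [es eb hd top1 _]]]]] vb; move: us.
rewrite es catA cat_uniq => /andP[us _].
rewrite nonrecord_catl ?mem_cat ?vb ?orbT //.
have nin w : w \in b -> w \notin s1.
  move: us; rewrite cat_uniq => /and3P[_ /hasPn h1 _]; apply: h1.
rewrite [in RHS]eb headed_nonrecord -?eb //.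
have hb : h \in b by rewrite eb mem_head.
apply/nonrecordP/idP => [[z lz vz]|vh].
  apply/eqP => e; move: lz; rewrite e !index_cat (negPf (nin h hb)).
  rewrite {2}eb /= eqxx addn0; case: ifP => [/top1|_]; first by rewrite -e; lia.
  by rewrite ltnNge leq_addr.
exists h.
  rewrite !index_cat !(negPf (nin _ _)) // ltn_add2l eb /= eqxx eq_sym.
  by rewrite (negPf vh).
by case: hd => _; apply; move: vb; rewrite eb inE (negPf vh).
Qed.

Lemma back_nbrs_block E s b v : uniq s -> is_block s b -> v \in b ->
  back_nbrs E s v = back_nbrs E b v.
Proof.
by move=> us bl vb; apply/setP => u; rewrite !inE (in_window_block _ us bl).
Qed.

Lemma adj_induced G b u v : adj (eset (induced G [set x in b])) u v =
  [&& adj (eset G) u v, u \in b & v \in b].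
Proof.
rewrite /adj inE; congr (_ && _); apply/subsetP/andP => [h|[ub vb] x].
  by have := h u; have := h v; rewrite !inE !eqxx ?orbT => -> // ->.
by rewrite !inE => /orP[]/eqP->.
Qed.

Lemma in_window_mem b u v : in_window b u v -> u \in b.
Proof.
move/in_window_lt; rewrite -index_mem => /leq_trans; apply; exact: index_size.
Qed.

Lemma back_nbrs_induced G b v : v \in b ->
  back_nbrs (eset (induced G [set x in b])) b v = back_nbrs (eset G) b v.
Proof.
move=> vb; apply/setP => u; rewrite !inE adj_induced vb andbT.
apply: andb_id2l => /in_window_mem ->; exact: andbT.
Qed.

(** * Odd permutations on a single block *)

Section Headed.

Variables (h : 'I_n) (t : seq 'I_n).
Hypothesis hd : headed h t.
Let b := h :: t.

(** The [r] of [search_connect_top] dominates a prefix containing [h], the maximum of [b], and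
    therefore equals [h]. *)
Lemma headed_connect T v : search_order b T -> v \in b -> connect (adj T) h v.
Proof.
move=> bT vb; have [ub top] := hd.
have [r [cr ler le]] := search_connect_top bT vb.
rewrite connect_adj_sym (_ : h = r) //; apply/val_inj/eqP.
rewrite eqn_leq le ?[index h _]/= ?eqxx //=.
have: r \in b by rewrite -index_mem (leq_ltn_trans ler) ?index_mem.
by rewrite inE => /orP[/eqP->//|/top/ltnW].
Qed.

Lemma headed_comp T : search_order b T -> connect (adj T) h =i b.
Proof.
move=> bT v; apply/idP/idP => [c|]; last exact: headed_connect.
have clos : closed (adj T) b.
  by move=> x y xy; have [-> ->] := search_adj_mem bT xy.
by rewrite -(closed_connect clos c) mem_head.
Qed.

Variable G : sgraph n.
Hypothesis G_full : vset G = [set: 'I_n].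
Let H := induced G [set x in b].

Lemma vset_induced : vset H = [set x in b].
Proof. by rewrite /H /= G_full setTI. Qed.

Lemma max_vertex_headed : max_vertex H = Some h.
Proof.
have [ub top] := hd; rewrite /max_vertex vset_induced.
have htop : [forall w in [set x in b], w <= h].
  by apply/forall_inP => w; rewrite !inE => /orP[/eqP->//|/top/ltnW].
case: pickP => [v|/(_ h)]; last by rewrite htop !inE eqxx.
rewrite !inE => /andP[/orP[/eqP->//|vt] /forall_inP/(_ h)].
by rewrite !inE eqxx => /(_ isT); have := top v vt; lia.
Qed.

Lemma entry_inj : injective (@entry n b).
Proof.
move=> i j; rewrite /entry !(tnth_nth h) /= => /eqP.
have [ub _] := hd; rewrite nth_uniq ?ltn_ord //.
by move/eqP/val_inj.
Qed.

Lemma index_entry (i : 'I_(size b)) : index (entry i) b = i.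
Proof. by have [ub _] := hd; rewrite /entry (tnth_nth h) index_uniq. Qed.

Lemma entry_mem (i : 'I_(size b)) : entry i \in b.
Proof. exact: mem_tnth. Qed.

Lemma entryP v : v \in b -> exists i : 'I_(size b), entry i = v.
Proof.
move=> vb; rewrite -index_mem in vb.
exists (Ordinal vb); rewrite /entry (tnth_nth h) /= nth_index //.
by rewrite -index_mem.
Qed.

Lemma entry_nonrecord (i : 'I_(size b)) : nonrecord b (entry i) = (0 < i).
Proof.
rewrite headed_nonrecord ?entry_mem // -[in RHS](index_entry i) /= eq_sym.
by case: eqP.
Qed.

(** [last_larger i <= k] says that every larger entry before [i] is at or before [k], so entries
    strictly between are smaller: the window condition. *)
Lemma in_Nt_set (i k : 'I_(size b)) : 0 < i ->
  (k \in Nt_set H i) = (entry k \in back_nbrs (eset H) b (entry i)).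
Proof.
move=> i0; rewrite [LHS]inE [RHS]inE; congr (_ && _).
apply/andP/in_windowP => [[/bigmax_leqP le lt]|[_ lt btw]].
  rewrite entry_nonrecord i0 !index_entry; split=> // w kw wi.
  have [l el] : exists l : 'I_(size b), entry l = w.
    by apply: entryP; rewrite -index_mem (ltn_trans wi).
  move: kw wi; rewrite -el index_entry => kl li.
  (* Entries are distinct, so an entry that is not larger is strictly smaller. *)
  rewrite ltnNge leq_eqVlt negb_or; apply/andP; split.
    by apply: contraTN li => /eqP/val_inj/entry_inj->; rewrite ltnn.
  by apply/negP => il; have := le l; rewrite li il => /(_ isT); lia.
move: lt; rewrite !index_entry => lt; split=> //.
apply/bigmax_leqP => l /andP[li il]; rewrite leqNgt; apply/negP => kl.
by have := btw (entry l); rewrite !index_entry => /(_ kl li); lia.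
Qed.

Lemma card_Nt_set (i : 'I_(size b)) : 0 < i ->
  #|Nt_set H i| = #|back_nbrs (eset G) b (entry i)|.
Proof.
move=> i0; rewrite -back_nbrs_induced ?entry_mem // -(card_imset _ entry_inj).
apply: eq_card => u; apply/imsetP/idP => [[k]|ub].
  by rewrite in_Nt_set // => h1 ->.
have [k ek] : exists k : 'I_(size b), entry k = u.
  by apply: entryP; move: ub; rewrite inE => /andP[/in_window_mem].
by exists k; rewrite // in_Nt_set // ek.
Qed.

Lemma first_back_entry (i k : 'I_(size b)) : 0 < i ->
  (k \in Nt_set H i) && [forall k' in Nt_set H i, k <= k'] =
  first_back (eset H) b (entry k) (entry i).
Proof.
move=> i0; rewrite in_Nt_set //; congr (_ && _).
apply/forall_inP/forall_inP => hk => [u ub|k'].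
  have [k' ek] : exists k : 'I_(size b), entry k = u.
    by apply: entryP; move: ub; rewrite inE => /andP[/in_window_mem].
  by rewrite -ek !index_entry; apply: hk; rewrite in_Nt_set // ek.
by rewrite in_Nt_set // => /hk; rewrite !index_entry.
Qed.

Lemma perm_forestE : perm_forest H b = first_forest (eset H) b.
Proof.
apply/setP => e; rewrite inE; apply/bigcupP/existsP => [[i i0]|[u]].
  case: pickP => [k|_]; last by rewrite inE.
  rewrite first_back_entry // => fb /set1P->.
  by exists (entry k); apply/existsP; exists (entry i); rewrite fb eqxx.
move=> /existsP[v /andP[fb /eqP->]].
have /andP[+ _] := fb; rewrite inE => /andP[win _].
have [i ei] : exists i : 'I_(size b), entry i = v.
  apply: entryP; have/in_windowP[nv _ _] := win.
  by move: (fb); rewrite /first_back inE adj_induced =>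
    /andP[/andP[_ /and3P[]]].
have [k ek] := entryP (in_window_mem win).
have i0 : 0 < i by rewrite -entry_nonrecord ei; have /in_windowP[] := win.
exists i => //; case: pickP => [k'|/(_ k)]; rewrite first_back_entry // ei.
  by move=> /first_back_unique/(_ fb) ->; apply/set1P.
by rewrite ek fb.
Qed.

Lemma headed_spanning_tree T : T \subset eset H ->
  search_order b T -> unique_back b T -> spanning_tree H T.
Proof.
move=> TH bT uT; rewrite /spanning_tree /spanning_forest TH.
rewrite (unique_back_acyclic bT uT) /=; apply/eqP.
(* The component of [h] fills [b], so a single connectivity class is counted. *)
rewrite -(n_comp_connect (connect_adj_sym T) h) /ncomp.
by apply: eq_n_comp_r => v; rewrite vset_induced inE (headed_comp bT).
Qed.

(** A headed block lists its vertices starting from the maximum. Oddness makes [b] a search order of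
    its first-neighbour forest, which is therefore a spanning tree. *)
Lemma odd_graph_permE : odd_graph_perm H b =
  [forall v in b, nonrecord b v ==> odd #|back_nbrs (eset G) b v|].
Proof.
have [ub _] := hd.
rewrite /odd_graph_perm max_vertex_headed eqxx perm_forestE.
have -> : perm_eq b (enum (vset H)).
  apply: uniq_perm => [||x]; rewrite ?enum_uniq //.
  by rewrite mem_enum vset_induced in_set.
rewrite !andTb; apply/andP/forall_inP =>
  [[_ /forallP odds] v /entryP[i <-]|odds].
  rewrite entry_nonrecord; apply/implyP => i0; rewrite -card_Nt_set //.
  by have := odds i; rewrite i0.
split; last first.
  apply/forallP => i; apply/implyP => i0; rewrite card_Nt_set //.
  by have := odds (entry i) (entry_mem i); rewrite entry_nonrecord i0.
apply: headed_spanning_tree (first_forest_sub _ _) _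
  (@first_forest_unique _ _ _).
apply: first_forest_search => [u v|v vb nv].
  rewrite adj_induced => /and3P[uv -> _]; split=> //.
  exact: adj_neq (subxx _) uv.
rewrite back_nbrs_induced //; exact: (implyP (odds v vb)).
Qed.

End Headed.

(** * Permutations in one-line notation *)

Lemma size_one_line (p : 'S_n) : size (one_line p) = n.
Proof. by rewrite size_map size_enum_ord. Qed.

Lemma one_line_uniq (p : 'S_n) : uniq (one_line p).
Proof. by rewrite map_inj_uniq ?enum_uniq //; apply: perm_inj. Qed.

Lemma mem_one_line (p : 'S_n) v : v \in one_line p.
Proof.
by apply/mapP; exists ((p^-1)%g v); rewrite ?mem_enum // permKV.
Qed.

Lemma nth_one_line (p : 'S_n) (i : 'I_n) : nth i (one_line p) i = p i.
Proof. by rewrite (nth_map i) ?size_enum_ord // nth_ord_enum. Qed.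

Lemma one_line_inj : injective (@one_line n).
Proof. by move=> p q epq; apply/permP => i; rewrite -!nth_one_line epq. Qed.

Lemma one_line_exists s : uniq s -> (forall v, v \in s) ->
  exists p, one_line p = s.
Proof.
move=> us fs.
have sz : size s = n.
  by rewrite -(card_uniqP us) (eq_card (B := 'I_n)) ?card_ord // => x;
    rewrite fs.
have inj : injective (fun i : 'I_n => nth i s i).
  move=> i j /=; rewrite (set_nth_default j) ?sz // => /eqP.
  by rewrite nth_uniq ?sz // => /eqP/val_inj.
(* The case split supplies a default entry for [nth]; an empty [s] forces [n = 0]. *)
exists (perm inj); case: s us fs sz inj => [|x0 s] us fs sz inj.
  by apply/nilP; rewrite /nilp size_one_line -sz.
apply: (@eq_from_nth _ x0); rewrite size_one_line // => i ltin.
have := nth_one_line (perm inj) (Ordinal ltin); rewrite permE => e.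
rewrite (set_nth_default (Ordinal ltin)) ?size_one_line // [LHS]e.
by apply: set_nth_default; rewrite sz.
Qed.

(** The blocks cover all vertices, and records and [back_nbrs] are the same in a block as in the
    whole sequence, so the conditions on the factors merge into one. *)
Lemma odd_partitionableE G (p : 'S_n) : vset G = [set: 'I_n] ->
  odd_partitionable G p =
  [forall v, nonrecord (one_line p) v ==>
     odd #|back_nbrs (eset G) (one_line p) v|].
Proof.
move=> GV; have us := one_line_uniq p; set s := one_line p in us *.
apply/allP/forallP => [hb v|hv b bb].
  have [b bb vb] := basic_decomp_cover us (mem_one_line p v).
  have bl := basic_decomp_block us bb.
  have := hb b bb; case: (bl) => s1 [s2 [h [t [_ eb hd _ _]]]].
  rewrite eb odd_graph_permE // -eb => /forall_inP/(_ v vb).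
  by rewrite -(block_nonrecord us bl) // -(back_nbrs_block _ us bl).
have bl := basic_decomp_block us bb.
case: (bl) => s1 [s2 [h [t [_ eb hd _ _]]]].
rewrite eb odd_graph_permE // -eb; apply/forall_inP => v vb.
by rewrite -(block_nonrecord us bl) // -(back_nbrs_block _ us bl).
Qed.

End Blocks.

(** * Even-left forests *)

Section EvenLeft.

Variable n : nat.
Implicit Types (A E T F : {set {set 'I_n}}) (b s t : seq 'I_n).
Implicit Types (u v w x y z r h : 'I_n).

(** * The tree sequence of a block and the even-left condition *)

Section TreeOrder.

Variables (G : sgraph n) (h : 'I_n) (t : seq 'I_n) (T : {set {set 'I_n}}).
Hypothesis G_full : vset G = [set: 'I_n].
Hypothesis hd : headed h t.
Let b := h :: t.
Let H := induced G [set x in b].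
Hypothesis bT : search_order b T.

(** The next entry [x] of [b] is a nonrecord with an earlier neighbour, hence a candidate. Any other
    candidate [w] comes after [x], and its edge to the prefix passes over [x], so [x < w]. *)
Lemma tree_seq_headed : tree_seq H T = b.
Proof.
have [ub _] := hd; have [_ win back] := search_orderP _ _ bT.
rewrite /tree_seq max_vertex_headed //.
have -> : #|vset H|.-1 = size t.
  by rewrite vset_induced // cardsE (card_uniqP ub).
suff gen q p : b = (h :: p) ++ q -> tree_seq_from H T (size q) (h :: p) = b.
  exact: (gen t [::]).
elim: q p => [|x q IH] p eb; first by rewrite eb cats0.
have xp : x \notin h :: p.
  by move: ub; rewrite -/b eb cat_uniq /= negb_or -!andbA => /and4P[_ _ + _].
have candE w : (w \in next_candidates H T (h :: p)) =
    [&& w \in b, w \notin h :: p & has (fun u => adj T u w) (h :: p)].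
  by rewrite [LHS]inE vset_induced // in_set.
have ix : index x b = size (h :: p)
  by rewrite eb index_cat (negPf xp) /= eqxx addn0.
have ip u : u \in h :: p -> index u b < size (h :: p).
  by move=> up; rewrite eb index_cat up index_mem.
have xb : x \in b by rewrite eb mem_cat mem_head orbT.
have nx : nonrecord b x.
  by rewrite headed_nonrecord //; apply: contraNneq xp => ->; apply: mem_head.
have xc : x \in next_candidates H T (h :: p).
  rewrite candE xb xp /=; have [u ux lt] := back x xb nx.
  have: u \in h :: p.
    by move: lt; rewrite ix eb index_cat; case: ifP => // _;
      rewrite ltnNge leq_addr.
  by rewrite inE => /orP[/eqP<-|up]; rewrite ?ux //; apply/orP; right;
    apply/hasP; exists u.
have xmin w : w \in next_candidates H T (h :: p) -> x <= w.
  rewrite candE => /and3P[wb wp /hasP[u up uw]].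
  have [->//|wx] := eqVneq x w.
  have iw : index x b < index w b.
    rewrite ix eb index_cat (negPf wp) /= (negPf wx).
    by rewrite addnS ltnS leq_addr.
  have ux : index u b < index x b by rewrite ix; apply: ip.
  have /in_windowP[_ _ btw] := win u w uw (ltn_trans ux iw).
  exact: ltnW (btw x ux iw).
rewrite /=; case: pickP => [w|/(_ x)]; last first.
  by rewrite xc /= => /negP[]; apply/forall_inP.
move=> /andP[wc /forall_inP/(_ x xc) le].
have -> : w = x by apply/val_inj/eqP; rewrite eqn_leq le xmin.
by apply: IH; rewrite eb /= cat_rcons.
Qed.

Hypothesis uT : unique_back b T.
Hypothesis TG : T \subset eset G.

Lemma mem_vset w : (w \in vset H) = (w \in b).
Proof. by rewrite vset_induced // in_set. Qed.

Section Vertex.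

Variables (u0 v : 'I_n).
Hypotheses (vb : v \in b) (nv : nonrecord b v).
Hypotheses (u0v : adj T u0 v) (lt0 : index u0 b < index v b).

Lemma tree_pred_headed : tree_pred H T v = u0.
Proof.
rewrite /tree_pred /tpos tree_seq_headed;
  case: pickP => [u /andP[uv lt]|/(_ u0)].
  by apply: (uT uv u0v).
by rewrite u0v lt0.
Qed.

Lemma adj_diff_induced w : w \in b ->
  ([set w; v] \in eset H :\: T) = adj (eset G) w v && ~~ adj T w v.
Proof.
by move=> wb; rewrite in_setD -!/(adj _ _ _) adj_induced wb vb !andbT andbC.
Qed.

Lemma not_tree_back w : index w b < index v b -> index w b != index u0 b ->
  ~~ adj T w v.
Proof. by move=> lt; apply: contra => wv; rewrite (uT wv u0v lt lt0). Qed.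

Lemma u0_window : in_window b u0 v.
Proof. by have [_ win _] := search_orderP _ _ bT; apply: win. Qed.

(** Everything between [u0] and [v] is below [v], so every neighbour there is in the window, and it
    is not a tree neighbour because [u0] is the only earlier one. *)
Lemma N_set_headed :
  N_set H T v = [set w in back_nbrs (eset G) b v | index u0 b < index w b].
Proof.
apply/setP => w.
rewrite [LHS]inE /tpos tree_pred_headed tree_seq_headed mem_vset [RHS]inE.
have [wb|wb] := boolP (w \in b); last first.
  by rewrite andFb; apply/esym/negbTE; apply: contra wb => /andP[+ _];
    rewrite inE => /andP[/in_window_mem].
rewrite adj_diff_induced // andTb.
apply/andP/andP => [[/andP[wv nwv] /andP[lt1 lt2]]|[wb' lt1]].
  split=> //; rewrite inE wv andbT; have /in_windowP[_ _ btw] := u0_window.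
  apply/in_windowP; split=> // x x1; apply: btw; exact: ltn_trans x1.
have /andP[win wv] : in_window b w v && adj (eset G) w v by rewrite inE in wb'.
have lt2 := in_window_lt win; rewrite wv lt1 lt2 not_tree_back //.
by rewrite neq_ltn lt1 orbT.
Qed.

Lemma rightmost_inversion_headed :
  let r := rightmost_inversion H T v in
  [/\ v < r, index r b < index v b &
      forall w, index r b < index w b -> index w b < index v b -> w < v].
Proof.
rewrite /rightmost_inversion /tpos tree_seq_headed vset_induced //.
case: pickP => [r|no] /=.
  move=> /andP[_ /and3P[vr lt /forall_inP btw]]; split=> // w w1 w2.
  have := btw w; rewrite in_set w1 w2; apply=> //.
  exact: index_lt_mem vb w2.
(* The default value cannot occur: the last of the larger vertices before [v] satisfies the tested
   condition. *)
have /nonrecordP[z0 lz0 vz0] := nv.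
pose P := [pred z : 'I_n | (index z b < index v b) && (v < z)].
have Pz0 : P z0 by rewrite /= lz0.
case: (@arg_maxnP _ z0 P (fun z => index z b) Pz0) => r /andP[lr vr] rmax.
have := no r; rewrite in_set (index_lt_mem vb lr) vr lr /= => /negP[].
apply/forall_inP => w; rewrite in_set => wb; apply/implyP => /andP[rw wv].
rewrite ltnNge leq_eqVlt negb_or; apply/andP; split.
  by apply: contraTN wv => /eqP/val_inj <-; rewrite ltnn.
apply/negP => vw; have: P w by rewrite /= wv vw.
by move/rmax => /=; rewrite leqNgt rw.
Qed.

(** The rightmost inversion vertex delimits the window: an earlier neighbour of [v] lies in it
    exactly when it is not before that vertex. *)
Lemma M_set_headed :
  M_set H T v = [set w in back_nbrs (eset G) b v | index w b < index u0 b].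
Proof.
have [vr lr btwr] := rightmost_inversion_headed.
apply/setP => w.
rewrite [LHS]inE /tpos tree_pred_headed tree_seq_headed mem_vset [RHS]inE.
set r := rightmost_inversion H T v in vr lr btwr *.
have [wb|wb] := boolP (w \in b); last first.
  by rewrite andFb; apply/esym/negbTE; apply: contra wb => /andP[+ _];
    rewrite inE => /andP[/in_window_mem].
rewrite adj_diff_induced // andTb.
apply/andP/andP => [[/andP[wv nwv] /andP[le1 lt2]]|[wb' lt1]].
  split=> //; rewrite inE wv andbT; apply/in_windowP; split=> //.
    exact: ltn_trans lt0.
  by move=> x x1; apply: btwr; apply: leq_ltn_trans x1.
have /andP[win wv] : in_window b w v && adj (eset G) w v by rewrite inE in wb'.
have lt2 := in_window_lt win; rewrite wv lt1 not_tree_back ?andbT //;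
  last first.
  by rewrite neq_ltn lt1.
split=> //; rewrite leqNgt; apply/negP => wr.
have /in_windowP[_ _ /(_ r wr lr)] := win.
by rewrite ltnNge (ltnW vr).
Qed.

(** [M_set] is empty iff [u0] is the first element of [back_nbrs]. In that case [back_nbrs] consists
    of [u0] and [N_set], so their cardinalities have opposite parities. *)
Lemma even_left_vertex :
  ~~ odd #|N_set H T v| && (M_set H T v == set0) =
  odd #|back_nbrs (eset G) b v| && first_back (eset G) b u0 v.
Proof.
have bu0 : u0 \in back_nbrs (eset G) b v.
  by rewrite inE u0_window; apply: (subsetP TG).
have -> : (M_set H T v == set0) = first_back (eset G) b u0 v.
  rewrite M_set_headed /first_back bu0 andTb;
    apply/eqP/forall_inP => [M0 w wb|le].
    rewrite leqNgt; apply/negP => lt.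
    have: w \in set0 by rewrite -M0 in_set wb lt.
    by rewrite in_set0.
  by apply/setP => w; rewrite in_set in_set0 ltnNge;
    apply/negbTE/negP => /andP[/le ->].
apply: andb_id2r => /andP[_ /forall_inP le].
rewrite N_set_headed [#|back_nbrs _ _ _|](cardsD1 u0) bu0 add1n oddS.
congr (~~ odd _); apply: eq_card => w; rewrite [LHS]in_set in_setD1 [RHS]andbC.
apply: andb_id2l => wb; rewrite ltn_neqAle le // andbT; congr negb.
apply/eqP/eqP => [e|-> //]; apply/esym/(index_inj_in _ e).
exact: index_lt_mem vb lt0.
Qed.

End Vertex.

Lemma even_left_headed :
  reflect (forall v, v \in b -> nonrecord b v ->
             odd #|back_nbrs (eset G) b v| /\
             forall u, adj T u v -> index u b < index v b ->
               first_back (eset G) b u v)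
          (even_left_tree H T).
Proof.
have [_ _ back] := search_orderP _ _ bT.
have nonh v : v \in b -> (Some v != max_vertex H) = nonrecord b v.
  by move=> vb; rewrite max_vertex_headed // headed_nonrecord.
rewrite /even_left_tree /even_tree /left_tree vset_induced //.
apply: (iffP andP) => [[/forall_inP ev /forall_inP lf] v vb nv|hb].
  have [u uv lt] := back v vb nv.
  have := even_left_vertex vb nv uv lt.
  have := ev v; have := lf v; rewrite in_set vb nonh // nv /=.
  move=> /(_ isT)-> /(_ isT)-> /esym/andP[-> fu]; split=> // u' u'v lt'.
  by rewrite (uT u'v uv lt' lt).
suff both v : v \in b -> nonrecord b v ->
    ~~ odd #|N_set H T v| && (M_set H T v == set0).
  split; apply/forall_inP => v; rewrite in_set => vb; rewrite nonh //;
  by apply/implyP => nv; have /andP[] := both v vb nv.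
move=> vb nv; have [u uv lt] := back v vb nv.
rewrite (even_left_vertex vb nv uv lt); have [-> fb] := hb v vb nv.
exact: fb.
Qed.

End TreeOrder.

Lemma adj_induced_edges F b u v : adj (induced_edges F [set x in b]) u v =
  [&& adj F u v, u \in b & v \in b].
Proof.
rewrite /adj inE; congr (_ && _); apply/subsetP/andP => [h|[ub vb] x].
  by have := h u; have := h v; rewrite !inE !eqxx ?orbT => -> // ->.
by rewrite !inE => /orP[]/eqP->.
Qed.

(** * Restricting a search order to a block *)

Section BlockOrder.

Variables (s b : seq 'I_n).
Hypotheses (us : uniq s) (bl : is_block s b).

Lemma index_block_lt u v : u \in b -> v \in b ->
  (index u s < index v s) = (index u b < index v b).
Proof.
move: bl us => [s1 [s2 [h [t [es _ _ _ _]]]]]; rewrite es.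
rewrite !cat_uniq => /and3P[_ /hasPn nin _] ub vb.
have nin1 w : w \in b -> (w \in s1) = false.
  by move=> wb; apply/negbTE/nin; rewrite mem_cat wb.
by rewrite !index_cat !nin1 // ub vb ltn_add2l.
Qed.

Lemma first_back_block E u v : v \in b ->
  first_back E s u v = first_back E b u v.
Proof.
move=> vb; rewrite /first_back (back_nbrs_block _ us bl) //.
have memb w : w \in back_nbrs E b v -> w \in b.
  by rewrite inE => /andP[/in_window_mem].
apply: andb_id2l => /memb ub; apply: eq_forallb_in => w /memb wb.
by rewrite leqNgt index_block_lt // -leqNgt.
Qed.

Variable F : {set {set 'I_n}}.
Hypothesis sF : search_order s F.

(** Windows stay inside a block, so an edge of [F] whose later end is in [b] has its earlier end
    there too. *)
Lemma search_order_block : search_order b (induced_edges F [set x in b]).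
Proof.
have [h1 h2 h3] := search_orderP _ _ sF; apply/search_orderP; split.
- move=> u v; rewrite adj_induced_edges => /and3P[uv -> _]; split=> //.
  by have [] := h1 u v uv.
- move=> u v; rewrite adj_induced_edges => /and3P[uv ub vb] lt.
  by rewrite -(in_window_block _ us bl) // h2 // index_block_lt.
- move=> v vb; rewrite -(block_nonrecord us bl) // => nv.
  have vs : v \in s by move: bl => [s1 [s2 [h [t [-> _ _ _ _]]]]];
    rewrite !mem_cat vb orbT.
  have [u uv lt] := h3 v vs nv; have := h2 u v uv lt.
  rewrite (in_window_block _ us bl) // => win; exists u;
    last exact: in_window_lt win.
  by rewrite adj_induced_edges uv vb (in_window_mem win).
Qed.

Lemma unique_back_block :
  unique_back s F -> unique_back b (induced_edges F [set x in b]).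
Proof.
move=> uF u u' v; rewrite !adj_induced_edges =>
  /and3P[uv ub vb] /and3P[u'v u'b _].
by rewrite -!index_block_lt //; apply: uF.
Qed.

(** All of [b] is connected to its head. Conversely, by [search_connect_record], a vertex connected
    to [h] is not before [h], nor at or past the next head [h'], which would then be below [h]. *)
Lemma block_component x : x \in b -> (forall v, v \in s) ->
  [set y | connect (adj F) x y] = [set y in b].
Proof.
move=> xb fs; move: (bl) => [s1 [s2 [h [t [es eb hd top hs2]]]]].
have cb y : y \in b -> connect (adj F) h y.
  move=> yb; have := search_order_block; rewrite eb => /(headed_connect hd).
  rewrite -eb => /(_ y yb); apply: connect_sub => u v.
  by rewrite adj_induced_edges => /and3P[uv _ _]; apply: connect1.
have hb : h \in b by rewrite eb mem_head.
apply/setP => y; rewrite !in_set; apply/idP/idP => [cxy|yb]; last first.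
  by apply: connect_trans (cb y yb); rewrite connect_adj_sym cb.
have rech : ~~ nonrecord s h.
  by rewrite (block_nonrecord us bl) // eb headed_nonrecord ?mem_head // eqxx.
have [le btw] := search_connect_record sF rech (connect_trans (cb x xb) cxy).
have hs1 : h \notin s1.
  by apply/negP => /top; rewrite ltnn.
move: (fs y); rewrite es !mem_cat => /or3P[ys1|//|ys2].
  have := le; rewrite es !index_cat (negPf hs1) ys1.
  move=> {}le; move: ys1; rewrite -index_mem.
  by move=> /leq_trans/(_ (leq_trans (leq_addr _ _) le)); rewrite ltnn.
apply: contraLR isT => yb.
case: s2 es hs2 ys2 => // h' s2' es hs2 ys2.
have hh' := hs2 h' s2' erefl.
have nin z : z \in h' :: s2' -> z \notin s1 /\ z \notin b.
  move=> zs2; move: us;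
    rewrite es catA cat_uniq => /and3P[_ /hasPn/(_ z zs2) + _].
  by rewrite mem_cat negb_or => /andP.
have [h's1 h'b] := nin h' (mem_head _ _); have [ys1 _] := nin y ys2.
have := btw h'; rewrite es !index_cat hb (negPf hs1) (negPf h's1) (negPf h'b).
rewrite (negPf ys1) (negPf yb) ltn_add2l /= eqxx addn0 index_mem.
rewrite leq_add2l leq_addr => /(_ hb isT) h'h.
by have := ltn_trans hh' h'h; rewrite ltnn.
Qed.

End BlockOrder.

(** The components of [F] are the blocks of [s], so [even_left_headed] applies block by block; its
    statements about [b] carry over to [s] because parities and first neighbours are local to a
    block. *)
Lemma even_left_forestE (G : sgraph n) s F :
    vset G = [set: 'I_n] -> uniq s -> (forall v, v \in s) ->
    search_order s F -> F \subset eset G ->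
  (F \in even_left_forests G) =
  [forall v, nonrecord s v ==> odd #|back_nbrs (eset G) s v|] &&
  (F == first_forest (eset G) s).
Proof.
move=> GV us fs sF FG; have [h1 h2 h3] := search_orderP _ _ sF.
have TG b : induced_edges F [set x in b] \subset eset G.
  by apply: subset_trans FG; apply/subsetP => e; rewrite inE => /andP[].
rewrite inE /spanning_forest FG /=.
apply/andP/andP => [[acy /forall_inP elC]|[/forallP odds /eqP eF]].
  have uF := acyclic_unique_back sF acy.
  have main v : nonrecord s v -> odd #|back_nbrs (eset G) s v| /\
      forall u, adj F u v -> index u s < index v s -> first_back (eset G) s u v.
    move=> nv; have [b bb vb] := basic_decomp_cover us (fs v).
    have bl := basic_decomp_block us bb.
    have bT := search_order_block us bl sF.
    have uT := unique_back_block us bl uF.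
    have cC : [set x in b] \in components G F.
      apply/imsetP; exists v;
        rewrite ?GV ?inE // -(block_component us bl sF vb fs).
      by apply/setP => y; rewrite !inE.
    have := elC _ cC.
    have [s1 [s2 [h [t [_ eb hd _ _]]]]] := bl.
    rewrite (block_nonrecord us bl) // in nv.
    rewrite eb in bT uT *; move=> /(even_left_headed GV hd bT uT (TG _)).
    rewrite -eb => /(_ v vb nv)[oddb fb].
    rewrite (back_nbrs_block _ us bl) //; split=> // u uv lt.
    have ub : u \in b.
      apply: in_window_mem (v) _; rewrite -(in_window_block _ us bl) //.
      exact: h2.
    rewrite (first_back_block us bl) //; apply: fb;
      last by rewrite -(index_block_lt us bl).
    by rewrite adj_induced_edges uv ub.
  split; first by apply/forallP => v; apply/implyP => /main[].
  (* Oriented along [s], an edge of [F] starts at the first earlier neighbour of its end.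
     Conversely, each nonrecord has an edge of [F] going back, and it must be that one. *)
  apply/eqP/setP => e; apply/idP/idP => [eFe|].
    have [u [v [ee ne]]] := edgeP (subsetP FG e eFe).
    have uv : adj F u v by rewrite /adj -ee.
    have fbe x y : adj F x y -> index x s < index y s ->
      first_back (eset G) s x y.
      move=> xy lt; have /in_windowP[ny _ _] := h2 x y xy lt.
      by have [_] := main y ny; apply.
    rewrite ee -/(adj _ _ _) adj_first_forest.
    case: (search_adj_lt sF uv) => lt; first by rewrite fbe.
    by rewrite (fbe v u) ?orbT // adjC.
  rewrite inE => /existsP[u /existsP[v /andP[fb /eqP->]]].
  have nv : nonrecord s v.
    by move: (fb); rewrite /first_back inE => /andP[/andP[/and3P[]]].
  have [u' u'v lt] := h3 v (fs v) nv; have [_ /(_ u' u'v lt) fb'] := main v nv.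
  by rewrite -/(adj F u v) (first_back_unique fb fb').
have uF : unique_back s F by rewrite eF; apply: first_forest_unique.
split; first exact: unique_back_acyclic sF uF.
apply/forall_inP => C /imsetP[x _ ->];
  have [b bb xb] := basic_decomp_cover us (fs x).
have bl := basic_decomp_block us bb.
have -> : [set y in vset G | connect (adj F) x y] = [set y in b].
  by rewrite -(block_component us bl sF xb fs) GV; apply/setP => y;
    rewrite !inE.
have bT := search_order_block us bl sF.
have uT := unique_back_block us bl uF.
have [s1 [s2 [h [t [_ eb hd _ _]]]]] := bl.
rewrite eb in bT uT *; apply/(even_left_headed GV hd bT uT (TG _)).
rewrite -eb => v vb; rewrite -(block_nonrecord us bl) // => nv.
rewrite -(back_nbrs_block _ us bl) //; split; first by have := odds v;
  rewrite nv.
move=> u; rewrite adj_induced_edges => /and3P[uv ub _] lt.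
rewrite -(first_back_block us bl) //; apply: first_forest_back; rewrite -?eF //.
by rewrite (index_block_lt us bl).
Qed.

End EvenLeft.

(** * The bijection and the Tutte polynomial *)

Section Main.

Import GRing.Theory.

Variables (n : nat) (G : sgraph n).
Hypothesis G_full : vset G = [set: 'I_n].
Implicit Types A F : {set {set 'I_n}}.

(** The default is never reached for [A] inside [eset G], where a search order exists. *)
Definition search_perm (A : {set {set 'I_n}}) : 'S_n :=
  odflt 1%g [pick p | search_order (one_line p) A].

(** Existence and uniqueness of the search order in one Boolean equation, a form that collapses a
    sum over permutations to one term. *)
Lemma search_permE A (p : 'S_n) : A \subset eset G ->
  search_order (one_line p) A = (p == search_perm A).
Proof.
move=> AG.
have sA : search_order (one_line (search_perm A)) A.
  rewrite /search_perm; case: pickP => //= no.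
  have [s [us fs sA]] := search_order_exists (fun u v => @adj_neq _ G A u v AG).
  by have [q eq] := one_line_exists us fs; have := no q; rewrite eq sA.
apply/idP/eqP => [sp|-> //]; apply: one_line_inj.
by apply: search_order_unique sp sA; rewrite ?one_line_uniq // => v;
  apply: mem_one_line.
Qed.

Lemma Upsilon_forest p : p \in Upsilon_odd G ->
  let F := first_forest (eset G) (one_line p) in
  F \in even_left_forests G /\ search_perm F = p.
Proof.
rewrite inE odd_partitionableE // => odds F.
have FG : F \subset eset G by apply: first_forest_sub.
have sF : search_order (one_line p) F.
  apply: first_forest_search => [u v uv|v _ nv];
    last exact: (implyP (forallP odds v)).
  by rewrite mem_one_line; split=> //; apply: adj_neq (subxx _) uv.
split; last by apply/esym/eqP; rewrite -search_permE.
by rewrite (even_left_forestE G_full (one_line_uniq p) (@mem_one_line _ p)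
  sF FG) odds eqxx.
Qed.

Lemma forest_Upsilon F : F \in even_left_forests G ->
  search_perm F \in Upsilon_odd G /\
  first_forest (eset G) (one_line (search_perm F)) = F.
Proof.
move=> FE; have FG : F \subset eset G by move: FE;
  rewrite inE => /andP[/andP[]].
set p := search_perm F.
have sF : search_order (one_line p) F by rewrite search_permE.
move: FE; rewrite (even_left_forestE G_full (one_line_uniq p)
  (@mem_one_line _ p) sF FG).
by rewrite inE odd_partitionableE // => /andP[-> /eqP <-].
Qed.

(** At x = 2 the factor x - 1 is 1 and the corank term disappears; at y = -1 the factor y - 1 is
    -2. *)
Lemma tutte_eval :
  ((tutte G).[2, -1] =
   \sum_(A : {set {set 'I_n}} | A \subset eset G)
      (- 2%:R) ^+ (#|A| - rk G A))%R.
Proof.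
rewrite /tutte !horner_sum; apply: eq_big => [A|A _];
  first by rewrite powersetE.
by rewrite !hornerE (_ : 2 - 1 = 1)%R // expr1n mul1r.
Qed.

Lemma tutte_Upsilon : ((tutte G).[2, -1] = #|Upsilon_odd G|%:R)%R.
Proof.
rewrite tutte_eval.
(* The inner sum has a single term, for the unique search order of [A], whose nonrecords number the
   rank of [A]. *)
transitivity (\sum_(A : {set {set 'I_n}} | A \subset eset G)
  \sum_(p : 'S_n | search_order (one_line p) A)
    (- 2%:R) ^+ (#|A| - #|[set v | nonrecord (one_line p) v]|) : int)%R.
  apply: eq_bigr => A AG.
  rewrite (eq_bigl (pred1 (search_perm A))) => [|p]; last exact: search_permE.
  rewrite big_pred1_eq (rk_nonrecord G_full
    (@mem_one_line _ (search_perm A))) //.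
  by rewrite search_permE.
(* Exchanging the sums groups edge sets by search order, and each permutation then contributes 1 or
   0. *)
rewrite (exchange_big_dep xpredT) //=.
under eq_bigr => p _ do rewrite (sum_search_order _ (@mem_one_line _ p)).
rewrite -natr_sum -sum1_card [in RHS]big_mkcond /=; congr (_%:R)%R.
by apply: eq_bigr => p _; rewrite inE odd_partitionableE //; case: ifP => ->.
Qed.

End Main.

Theorem theorem1p2 (n : nat) (G : sgraph n)
    (G_vertices : vset G = [set: 'I_n]) (G_connected : connected_graph G) :
  (exists f : {p : 'S_n | p \in Upsilon_odd G} ->
              {F : {set {set 'I_n}} | F \in even_left_forests G},
     bijective f) /\
  ((tutte G).[2, -1] = #|Upsilon_odd G|%:R)%R.
Proof.
split; last exact: tutte_Upsilon.
(* The first halves of [Upsilon_forest] and [forest_Upsilon] supply the membership proofs; the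
   second halves are the two cancellation laws. *)
pose f (p : {p : 'S_n | p \in Upsilon_odd G}) :
    {F : {set {set 'I_n}} | F \in even_left_forests G} :=
  exist (fun F => F \in even_left_forests G) _
    (proj1 (Upsilon_forest G_vertices (valP p))).
pose g (F : {F : {set {set 'I_n}} | F \in even_left_forests G}) :
    {p : 'S_n | p \in Upsilon_odd G} :=
  exist (fun p => p \in Upsilon_odd G) _
    (proj1 (forest_Upsilon G_vertices (valP F))).
exists f, g => x; apply: val_inj => /=.
  exact: (proj2 (Upsilon_forest G_vertices (valP x))).
exact: (proj2 (forest_Upsilon G_vertices (valP x))).
Qed.
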